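(* Let $f \in \mathbb{C}[z][x]$ be a bihomogeneous polynomial in the variables $x = (x_0,\ldots,x_d)$ and the parameters $z = (z_0,\ldots,z_m)$, let $Z \subseteq \mathbb{P}^m$ be any irreducible quasi-projective variety such that there is no $z \in Z$ for which $f(x,z)$ is identically zero as a polynomial in $x$, and put $F(x,z) = x_0 \cdots x_d\, f(x,z)$ and $\mathcal{X}_F = \{(x,z)\in\mathbb{P}^d\times Z : F(x,z)\neq 0\}$. For $\nu = (\nu_0:\nu_1:\cdots:\nu_d) \in \mathbb{P}^d$ let $$\mathcal{Y}_\nu^\circ = \left\{ (x,z) \in \mathcal{X}_F : \frac{\nu_i}{x_i} + \nu_0\, \frac{\partial_i f(x,z)}{f(x,z)} = 0, \ i = 1,\ldots,d \right\},$$ and let $\mathcal{Y}_\nu$ be the closure of $\mathcal{Y}_\nu^\circ$ in $\mathbb{P}^d \times Z$. If $\nu \in \mathbb{P}^d$ is generic, then the variety $\mathcal{Y}_\nu \cap V(F)$ has dimension at most $\dim Z - 1$. Hence $\pi_Z(\mathcal{Y}_\nu \cap V(F)) \subsetneq Z$ is a strict containment.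
   Context: All varieties are over $\mathbb{C}$. Here $\partial_i f = \frac{\partial f}{\partial x_i}$, $V(F) = \{(x,z) \in \mathbb{P}^d \times Z : F(x,z) = 0\}$, and $\pi_Z : \mathbb{P}^d \times Z \to Z$ is the projection. ''Generic $\nu$'' means that the statement holds for all $\nu$ in some dense Zariski-open subset of $\mathbb{P}^d$. *)

(* Defs.v *)
(* mpoly has to be imported before the topology files: the notation levels
   clash in the other order. *)
From HB Require Import structures.
From mathcomp Require Import all_boot all_order all_algebra.
From mathcomp Require Import mpoly complex.
From mathcomp Require Import boolp classical_sets reals ereal topology.

Set Implicit Arguments.
Unset Strict Implicit.
Unset Printing Implicit Defensive.

Import Order.TTheory GRing.Theory Num.Theory.
Local Open Scope classical_set_scope.
Local Open Scope ring_scope.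
Local Open Scope quotient_scope.

(* Two nonzero row vectors span the same line iff they have the same row
   space. *)

Definition nzvec (K : fieldType) (n : nat) := {v : 'rV[K]_n.+1 | v != 0}.

Definition same_line (K : fieldType) (n : nat) : rel (nzvec K n) :=
  fun u v => (val u == val v)%MS.

Lemma same_line_refl (K : fieldType) n : reflexive (@same_line K n).
Proof. by move=> u; rewrite /same_line submx_refl. Qed.

Lemma same_line_sym (K : fieldType) n : ssrbool.symmetric (@same_line K n).
Proof. by move=> u v; rewrite /same_line andbC. Qed.

Lemma same_line_trans (K : fieldType) n : transitive (@same_line K n).
Proof. by move=> v u w /eqmxP uv /eqmxP vw; apply/eqmxP; exact: eqmx_trans uv vw. Qed.

Canonical same_line_equiv (K : fieldType) n :=
  EquivRel (@same_line K n) (@same_line_refl K n) (@same_line_sym K n)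
    (@same_line_trans K n).

Definition projspace (K : fieldType) (n : nat) := {eq_quot @same_line_equiv K n}.

HB.instance Definition _ (K : fieldType) n := Choice.on (projspace K n).

(* Homogeneous coordinates of the representative chosen by the quotient. They
   are only meaningful up to a nonzero scalar; below they only occur in
   conditions that are homogeneous in them. *)
Definition hcoord (K : fieldType) n (x : projspace K n) : 'I_n.+1 -> K :=
  val (repr x) ord0.

(* C[z][x]: polynomials in x_0, .., x_d over C[z_0, .., z_m]. *)

Notation bipoly K d m := {mpoly {mpoly K[m.+1]}[d.+1]}.

(* Bihomogeneous of some bidegree (e1, e2). *)
Definition bihomog (K : fieldType) d m (f : bipoly K d m) : Prop :=
  exists e1 e2 : nat, f \is e1.-homog /\ forall mu, f@_mu \is e2.-homog.

(* f(x, z) as a polynomial in x, the point z being fixed. *)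
Definition specialize (K : fieldType) d m (f : bipoly K d m) (z : projspace K m) :
  {mpoly K[d.+1]} := map_mpoly (meval (hcoord z)) f.

Definition bieval (K : fieldType) d m (f : bipoly K d m)
  (x : projspace K d) (z : projspace K m) : K := (specialize f z).@[hcoord x].

(* Zariski topology: the nonvanishing loci of the (bi)homogeneous polynomials
   form a base of open sets, so that the closed sets are the common zero loci of
   families of (bi)homogeneous polynomials. *)

Definition proj_basic (K : fieldType) n : set (set (projspace K n)) :=
  [set B | exists2 p : {mpoly K[n.+1]}, (exists k, p \is k.-homog)
                     & B = [set x | p.@[hcoord x] != 0]].

Lemma proj_basic_cover (K : fieldType) n :
  \bigcup_(B in @proj_basic K n) B = setT.
Proof.
rewrite predeqE => x; split=> // _.
exists [set y | (1 : {mpoly K[n.+1]}).@[hcoord y] != 0].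
  by exists 1 => //; exists 0%N; exact: dhomog1.
by rewrite /= meval1 oner_neq0.
Qed.

Lemma proj_basic_join (K : fieldType) n (A B : set (projspace K n)) t :
  proj_basic A -> proj_basic B -> A t -> B t ->
  exists C, [/\ proj_basic C, C t & C `<=` A `&` B].
Proof.
move=> [p [a pa] ->] [q [b qb] ->] /= pt qt.
exists [set x | (p * q).@[hcoord x] != 0]; split => /=.
- by exists (p * q) => //; exists (a + b)%N; exact: dhomogM.
- by rewrite mevalM mulf_neq0.
- by move=> x /=; rewrite mevalM mulf_eq0 negb_or => /andP.
Qed.

HB.instance Definition _ (K : fieldType) n :=
  isBaseTopological.Build (projspace K n) (@proj_basic_cover K n)
    (@proj_basic_join K n).

(* P^d x P^m. This is an alias because the canonical topology on a pair type is
   the product topology, which is in general coarser than the Zariski one. *)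
Definition biproj (K : fieldType) (d m : nat) := (projspace K d * projspace K m)%type.

HB.instance Definition _ (K : fieldType) d m := Choice.on (biproj K d m).

Definition biproj_basic (K : fieldType) d m : set (set (biproj K d m)) :=
  [set B | exists2 f : bipoly K d m, bihomog f
                     & B = [set xz | bieval f xz.1 xz.2 != 0]].

Lemma bihomog1 (K : fieldType) d m : bihomog (1 : bipoly K d m).
Proof.
exists 0%N, 0%N; split=> [|mu]; first exact: dhomog1.
by rewrite mcoeff1; case: eqP => _; [exact: dhomog1|exact: dhomog0].
Qed.

Lemma bihomogM (K : fieldType) d m (f g : bipoly K d m) :
  bihomog f -> bihomog g -> bihomog (f * g).
Proof.
move=> [a [b [fa fb]]] [a' [b' [ga gb]]].
exists (a + a')%N, (b + b')%N; split=> [|mu]; first exact: dhomogM.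
by rewrite mcoeffM rpred_sum // => k _; exact: dhomogM.
Qed.

Lemma bieval1 (K : fieldType) d m x z : bieval (1 : bipoly K d m) x z = 1.
Proof. by rewrite /bieval /specialize rmorph1 meval1. Qed.

Lemma bievalM (K : fieldType) d m (f g : bipoly K d m) x z :
  bieval (f * g) x z = bieval f x z * bieval g x z.
Proof. by rewrite /bieval /specialize rmorphM mevalM. Qed.

Lemma biproj_basic_cover (K : fieldType) d m :
  \bigcup_(B in @biproj_basic K d m) B = setT.
Proof.
rewrite predeqE => xz; split=> // _.
exists [set yz | bieval (1 : bipoly K d m) yz.1 yz.2 != 0].
  by exists 1 => //; exact: bihomog1.
by rewrite /= bieval1 oner_neq0.
Qed.

Lemma biproj_basic_join (K : fieldType) d m (A B : set (biproj K d m)) t :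
  biproj_basic A -> biproj_basic B -> A t -> B t ->
  exists C, [/\ biproj_basic C, C t & C `<=` A `&` B].
Proof.
move=> [f fh ->] [g gh ->] /= ft gt.
exists [set yz | bieval (f * g) yz.1 yz.2 != 0]; split => /=.
- by exists (f * g) => //; exact: bihomogM.
- by rewrite bievalM mulf_neq0.
- by move=> x /=; rewrite bievalM mulf_eq0 negb_or => /andP.
Qed.

HB.instance Definition _ (K : fieldType) d m :=
  isBaseTopological.Build (biproj K d m) (@biproj_basic_cover K d m)
    (@biproj_basic_join K d m).

(* Below, subsets of a topological space carry the subspace topology. *)

(* The closed subsets of S are the traces of closed sets of T, hence the shape
   of the covering condition. *)
Definition irreducible (T : topologicalType) (S : set T) : Prop :=
  S !=set0 /\
  forall A B : set T, closed A -> closed B ->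
    S `<=` A `|` B -> S `<=` A \/ S `<=` B.

Definition closed_in (T : topologicalType) (S C : set T) : Prop :=
  exists2 A : set T, closed A & C = S `&` A.

(* C_0 < C_1 < .. < C_k, irreducible closed subsets of S. *)
Definition irreducible_chain (T : topologicalType) (S : set T) (k : nat)
    (C : nat -> set T) : Prop :=
  (forall i, (i <= k)%N -> irreducible (C i) /\ closed_in S (C i)) /\
  (forall i, (i < k)%N -> C i `<` C i.+1).

(* Krull dimension; the dimension of the empty set is -oo. *)
Definition krull_dim (R : realType) (T : topologicalType) (S : set T) : \bar R :=
  ereal_sup [set k%:R%:E | k in [set k | exists C, irreducible_chain S k C]].

Definition quasi_projective (K : fieldType) m (Z : set (projspace K m)) : Prop :=
  exists A U : set (projspace K m), [/\ closed A, open U & Z = A `&` U].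

Section LikelihoodVariety.
Variables (K : fieldType) (d m : nat).
Variables (f : bipoly K d m) (Z : set (projspace K m)).

Definition Fpoly : bipoly K d m := (\prod_(i < d.+1) 'X_i) * f.

Definition XF : set (biproj K d m) :=
  [set xz | Z xz.2 /\ bieval Fpoly xz.1 xz.2 != 0].

Definition VF : set (biproj K d m) :=
  [set xz | Z xz.2 /\ bieval Fpoly xz.1 xz.2 = 0].

Definition Yo (nu : projspace K d) : set (biproj K d m) :=
  [set xz | XF xz /\
     forall i : 'I_d.+1, i != ord0 ->
       hcoord nu i / hcoord xz.1 i
       + hcoord nu ord0 * (bieval f^`M(i) xz.1 xz.2 / bieval f xz.1 xz.2) = 0].

(* Closure in P^d x Z. *)
Definition Y (nu : projspace K d) : set (biproj K d m) :=
  closure (Yo nu) `&` [set xz | Z xz.2].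

End LikelihoodVariety.

(* Main.v *)
Require Import Defs.
From HB Require Import structures.
From mathcomp Require Import all_boot all_order all_algebra.
From mathcomp Require closed_field.
From mathcomp Require Import ring.
From mathcomp Require Import mpoly complex.
From mathcomp Require Import boolp classical_sets reals ereal topology.

(** The map sending a point (x, z) with F(x, z) <> 0 to the logarithmic
    derivatives phi_i = x_i (d_i f) / f, for i = 1, .., d, has the sets Y°_nu
    as fibres: Y°_nu lies over the point (- nu_i / nu_0)_i. The source has
    dimension d + dim Z, so a general fibre has dimension at most dim Z. As F
    vanishes nowhere on Y°_nu and identically on the boundary, which is the
    intersection of Y_nu and V(F), passing from Y°_nu to the boundary loses one
    dimension.

    Dimension is measured by algebraic independence: [alg_dep S w] says that
    the functions w satisfy a nontrivial polynomial relation at all points of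
    S, without asking S to be irreducible. All sets are cut into the charts
    where a fixed x_i and a fixed z_j are nonzero, and t denotes the largest
    number of independent coordinates on Z in such a chart.

    - Upper bound. On P^d x Z every d + t + 1 chart coordinates are dependent
      ([bichart_coordinates_dep]); counting monomials, so are any d + t + 1
      polynomial functions divided by a common denominator
      ([alg_dep_quotients]). In particular the phi_i and any t + 1 chart
      coordinates satisfy a relation, and giving the phi_i the values
      prescribed by a generic nu leaves a relation between the t + 1
      coordinates on Y°_nu ([generic_fibre_relation]). A second count shows
      that any t + 1 polynomial functions are dependent on Y°_nu
      ([fibre_functions_dep]).
    - Loss of one dimension. Suppose that p vanishes on A, and that q vanishes
      on A whenever some p ^ a * q vanishes on B. Then functions independent on
      A are independent on B together with p ([alg_indep_extend]). Applied
      along a chain of irreducible sets this turns a chain of length k into k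
      independent functions ([chain_independent]). Applied to the boundary
      inside the closure of Y°_nu, with p = F, it shows that fewer than t
      functions can be independent on the boundary ([boundary_drop]).
    - Lower bound. Z has a chain of t + 1 irreducible closed subsets
      ([chain_of_independent_coordinates]): a generic hyperplane section of a
      locally closed set with s + 1 independent coordinates still has s of
      them independent, because the image of the set under these coordinates
      contains a nonempty Zariski open set, by quantifier elimination over an
      algebraically closed field ([projection_generic]); a minimal closed
      subset with that property, which exists by noetherianity, is
      irreducible.

    Thus a chain of length k in the boundary yields k < t <= dim Z. If the
    boundary projected onto Z, the t independent coordinates of Z would be
    independent on the part of the boundary in some chart, which
    [boundary_drop] excludes. *)

Set Implicit Arguments.
Unset Strict Implicit.
Unset Printing Implicit Defensive.

Import Order.TTheory GRing.Theory Num.Theory.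

Local Open Scope classical_set_scope.
Local Open Scope ring_scope.

(** * Points where a multivariate polynomial does not vanish *)

Local Notation widen := (widen_ord (leqnSn _)).

Section Nonvanishing.
Variable K : numFieldType.

Lemma poly_nonroot (p : {poly K}) : p != 0 -> exists x, p.[x] != 0.
Proof.
move=> p0; apply: contrapT => H.
have rt x : root p x by apply/rootP; apply: contra_notP H => /eqP; exists x.
pose s := [seq (i%:R : K) | i <- iota 0 (size p)].
have : (size s < size p)%N.
  apply: max_poly_roots => //; first by apply/allP => x _.
  by rewrite map_inj_uniq ?iota_uniq // => i j /eqP; rewrite eqr_nat => /eqP.
by rewrite size_map size_iota ltnn.
Qed.

(** Evaluates the last variable at x and all the others through f; the two uses
    are evaluation at a point and the embedding back into n + 1 variables. *)
Lemma mmap_muni n (S : comNzRingType) (f : {rmorphism {mpoly K[n]} -> S}) (x : S)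
    (p : {mpoly K[n.+1]}) :
  (map_poly f (muni p)).[x] =
  \sum_(m <- msupp p)
     f (p@_m *: 'X_[[multinom (m (widen i)) | i < n]]) * x ^+ (m ord_max).
Proof.
rewrite muniE rmorph_sum horner_sum; apply: eq_bigr => m _.
by rewrite -mul_polyC rmorphM /= map_polyC /= map_polyXn hornerM hornerC hornerXn.
Qed.

Lemma multinom_widen n (S : comNzRingType) (h : 'I_n.+1 -> S) (m : 'X_{1..n.+1}) :
  \prod_(i < n.+1) h i ^+ m i =
  (\prod_(i < n) h (widen i) ^+ [multinom (m (widen i)) | i < n] i) *
    h ord_max ^+ m ord_max.
Proof. by rewrite big_ord_recr /=; congr (_ * _); apply: eq_bigr => i _; rewrite mnmE. Qed.

Lemma meval_muni n (v : 'I_n.+1 -> K) (p : {mpoly K[n.+1]}) :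
  (map_poly (meval (v \o widen)) (muni p)).[v ord_max] = p.@[v].
Proof.
rewrite mmap_muni mevalE; apply: eq_bigr => m _.
by rewrite /= mevalZ mevalX multinom_widen mulrA.
Qed.

Lemma muni_eq0 n (p : {mpoly K[n.+1]}) : muni p = 0 -> p = 0.
Proof.
move=> p0; have: (map_poly (@mwiden n K) (muni p)).['X_ord_max] = 0.
  by rewrite p0 rmorph0 horner0.
rewrite mmap_muni => <-; rewrite {1}[p]mpolyE; apply: eq_bigr => m _.
rewrite /= mwidenZ mwidenX -scalerAl; congr (_ *: _).
rewrite (mpolyXE_id _ m) (mpolyXE_id _ (mnmwiden _)) !multinom_widen.
rewrite mnmwiden_ordmax expr0 mulr1; congr (_ * _).
by apply: eq_bigr => i _; rewrite !mnmE mnmwiden_widen mnmE.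
Qed.

Lemma mpoly_nonroot n (p : {mpoly K[n]}) : p != 0 -> exists v, p.@[v] != 0.
Proof.
elim: n p => [p p0|n IH p p0].
  have pE : p = (p@_0%MM)%:MP.
    apply/mpolyP => m; rewrite mcoeffC.
    have -> : m = 0%MM by apply/mnmP => -[].
    by rewrite eqxx mulr1.
  exists (fun=> 0); rewrite pE mevalC; apply: contra_neq p0 => p0.
  by rewrite pE p0 mpolyC0.
have A0 : muni p != 0 by apply: contra_neq p0; exact: muni_eq0.
have L0 : lead_coef (muni p) != 0 by rewrite lead_coef_eq0.
have [v vk] := IH _ L0.
have : map_poly (meval v) (muni p) != 0.
  apply: contra_neq vk => /(congr1 (fun q : {poly K} => q`_(size (muni p)).-1)).
  by rewrite coef_map coef0.
move=> /poly_nonroot[x px]; exists (fun i => oapp v x (unlift ord_max i)).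
rewrite -meval_muni unlift_none /=.
rewrite (_ : map_poly _ _ = map_poly (meval v) (muni p)) //.
apply: eq_map_poly => c; apply: meval_eq => i /=.
have -> : widen i = lift ord_max i by apply: val_inj; rewrite /= /bump leqNgt ltn_ord.
by rewrite liftK.
Qed.

Lemma comp_reindex_neq0 k l (s : 'I_k -> 'I_l) (P : {mpoly K[k]}) :
  injective s -> P != 0 -> P \mPo [tuple 'X_(s i) | i < k] != 0.
Proof.
move=> sI P0; have [v Pv] := mpoly_nonroot P0; apply: contra_neq Pv => Q0.
pose u j := oapp v 0 [pick i | s i == j].
have : (P \mPo [tuple 'X_(s i) | i < k]).@[u] = 0 by rewrite Q0 meval0.
rewrite comp_mpoly_meval => <-; apply: meval_eq => i.
rewrite tnth_mktuple mevalXU /u; case: pickP => [j /eqP/sI->//|/(_ i)].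
by rewrite eqxx.
Qed.

End Nonvanishing.

(** * Algebraic dependence of functions on a set *)

Section Dependence.
Variables (K : numFieldType) (T : Type).
Implicit Types (S : set T).

Definition alg_dep S k (w : 'I_k -> T -> K) : Prop :=
  exists2 P : {mpoly K[k]}, P != 0 & forall x, S x -> P.@[w^~ x] = 0.

(** Contrapositive: a subfamily of an independent family is independent. *)
Lemma alg_dep_reindex S k l (w : 'I_l -> T -> K) (s : 'I_k -> 'I_l) :
  injective s -> alg_dep S (fun i => w (s i)) -> alg_dep S w.
Proof.
move=> sI [P P0 PS]; exists (P \mPo [tuple 'X_(s i) | i < k]).
  exact: comp_reindex_neq0.
move=> x Sx; rewrite comp_mpoly_meval -[RHS](PS x Sx); apply: meval_eq => i.
by rewrite tnth_mktuple mevalXU.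
Qed.

Lemma alg_dep_sub S S' k (w : 'I_k -> T -> K) :
  S `<=` S' -> alg_dep S' w -> alg_dep S w.
Proof. by move=> SS' [P P0 PS]; exists P => // x /SS'/PS. Qed.

Lemma alg_depU S S' k (w : 'I_k -> T -> K) :
  alg_dep S w -> alg_dep S' w -> alg_dep (S `|` S') w.
Proof.
move=> [P P0 PS] [Q Q0 QS]; exists (P * Q); first by rewrite mulf_neq0.
by move=> x [/PS|/QS] e; rewrite mevalM e ?mul0r ?mulr0.
Qed.

Lemma alg_dep_bigcup (I : finType) (S : I -> set T) k (w : 'I_k -> T -> K) :
  (forall i, alg_dep (S i) w) -> alg_dep (\bigcup_i S i) w.
Proof.
move=> H; have [P PH] := choice (fun i => let: ex_intro2 P a b := H i in
  ex_intro (fun P : {mpoly K[k]} => P != 0 /\ forall x, S i x -> P.@[w^~ x] = 0)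
     P (conj a b)).
exists (\prod_i P i); first by apply/prodf_neq0 => i _; case: (PH i).
move=> x [i _ Sx]; rewrite rmorph_prod /= (bigD1 i) //=.
by rewrite (PH i).2 ?mul0r.
Qed.

Lemma alg_indep0 S (w : 'I_0 -> T -> K) : S !=set0 -> ~ alg_dep S w.
Proof.
move=> [x Sx] [P P0 /(_ x Sx)]; have [v Pv] := mpoly_nonroot P0.
by apply/eqP; rewrite (@meval_eq _ _ _ v) // => -[].
Qed.

Lemma alg_dep_const S k (w : 'I_k -> T -> K) i c :
  (forall x, S x -> w i x = c) -> alg_dep S w.
Proof.
move=> wi; exists ('X_i - c%:MP); last first.
  by move=> x /wi e; rewrite mevalB mevalXU mevalC e subrr.
apply/eqP => /(congr1 (meval (fun=> c + 1))).
by rewrite mevalB mevalXU mevalC meval0 addrAC subrr add0r => /eqP; rewrite oner_eq0.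
Qed.

End Dependence.

(** * Counting monomials *)

(** If every r of the coordinates are dependent on S, a monomial with r or more
    large exponents can be rewritten on S into smaller monomials. Hence every
    polynomial of degree at most d agrees on S with a combination of monomials
    having fewer than r large exponents, and there are O(d ^ (r - 1)) of them. *)
Section Counting.
Variables (K : numFieldType) (T : Type) (S : set T) (n : nat).
Variable (c : 'I_n -> T -> K).

Lemma msupp_comp_reindex r (J : 'I_r -> 'I_n) (P : {mpoly K[r]}) (nu : 'X_{1..n}) :
  injective J -> nu \in msupp (P \mPo [tuple 'X_(J i) | i < r]) ->
  (forall i, (nu (J i) < msize P)%N) /\ (forall j, j \notin codom J -> nu j = 0%N).
Proof.
move=> JI; rewrite comp_mpolyEX => /msupp_sum_le/flatten_mapP[mu].
rewrite mem_filter /= => muP.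
have -> : 'X_[mu] \mPo [tuple 'X_(J i) | i < r] =
   'X_[(\sum_i U_(J i) *+ mu i)%MM] :> {mpoly K[n]}.
  rewrite comp_mpolyX -mprodXnE; apply: eq_bigr => i _.
  by rewrite tnth_mktuple.
move/msuppZ_le; rewrite msuppX inE => /eqP->; split=> [i|j jJ].
  rewrite mnm_sumE (bigD1 i) //= mulmnE mnm1E eqxx mul1n big1 ?addn0.
    apply: leq_ltn_trans (msize_mdeg_lt muP).
    by rewrite mdegE (bigD1 i) //= leq_addr.
  by move=> k ki; rewrite mulmnE mnm1E (inj_eq JI) (negPf ki) mul0n.
rewrite mnm_sumE big1 // => i _; rewrite mulmnE mnm1E.
case: eqP => [e|]; last by rewrite mul0n.
by rewrite -e codom_f in jJ.
Qed.

(** The relation P, written in the variables J i, has a leading monomial dividing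
    m, so m times its tail replaces m by smaller monomials. *)
Lemma rewrite_monomial r (J : 'I_r -> 'I_n) (P : {mpoly K[r]}) (m : 'X_{1..n}) :
  injective J -> P != 0 -> (forall x, S x -> P.@[fun i => c (J i) x] = 0) ->
  (forall i, (msize P <= m (J i))%N) ->
  exists q : {mpoly K[n]}, (forall mu, mu \in msupp q -> (mu < m)%O) /\
    forall x, S x -> 'X_[m].@[c^~ x] = q.@[c^~ x].
Proof.
move=> JI P0 PS Pm; pose Q := P \mPo [tuple 'X_(J i) | i < r].
have Q0 : Q != 0 by exact: comp_reindex_neq0.
have [num nuz] := msupp_comp_reindex JI (mlead_supp Q0).
have le_m : (mlead Q <= m)%MM.
  apply/mnm_lepP => j; have [/codomP[i ->]|jJ] := boolP (j \in codom J).
    exact: leq_trans (ltnW (num i)) (Pm i).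
  by rewrite nuz.
have Qc0 : mleadc Q != 0 by rewrite mleadc_eq0.
exists ('X_[m - mlead Q] * ('X_[mlead Q] - (mleadc Q)^-1 *: Q)); split=> [mu|x Sx].
  move=> /msuppM_le/allpairsP[[a b] /= [am bm ->]].
  move: am; rewrite msuppX inE => /eqP->; rewrite -[X in (_ < X)%O](submK le_m).
  rewrite ltmc_add2r lt_neqAle; apply/andP; split.
    apply: contraTneq bm => ->; rewrite mcoeff_msupp negbK mcoeffB mcoeffZ mcoeffX.
    by rewrite eqxx mulVf ?subrr.
  have /msuppB_le := bm; rewrite mem_cat msuppX inE => /orP[/eqP->//|].
  by move/msuppZ_le/msupp_le_mlead.
rewrite mevalM mevalB mevalZ comp_mpoly_meval.
have -> : P.@[fun i => (tnth [tuple 'X_(J i) | i < r] i).@[c^~ x]] = 0.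
  by rewrite -[RHS](PS x Sx); apply: meval_eq => i; rewrite tnth_mktuple mevalXU.
by rewrite mulr0 subr0 -mevalM -mpolyXD submK.
Qed.

Variable (e : nat).
(** Once e exceeds the exponents of the relations at hand, every other monomial is
    divisible by the leading monomial of a relation between r coordinates. *)
Definition few_large r (m : 'X_{1..n}) := (#|[set j | e <= m j]%SET| < r)%N.

Definition reduced_on r d (f : T -> K) := exists q : {mpoly K[n]},
  (forall mu, mu \in msupp q -> few_large r mu && (mdeg mu <= d)%N) /\
  forall x, S x -> f x = q.@[c^~ x].

Lemma reduced_onD r d f g : reduced_on r d f -> reduced_on r d g ->
  reduced_on r d (fun x => f x + g x).
Proof.
move=> [p [ps pS]] [q [qs qS]]; exists (p + q); split=> [mu /msuppD_le|x Sx].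
  by rewrite mem_cat => /orP[/ps|/qs].
by rewrite mevalD pS ?qS.
Qed.

Lemma reduced_onZ r d a f : reduced_on r d f -> reduced_on r d (fun x => a * f x).
Proof.
move=> [p [ps pS]]; exists (a *: p); split=> [mu /msuppZ_le/ps//|x Sx].
by rewrite mevalZ pS.
Qed.

Lemma reduced_on_eq r d f g : (forall x, S x -> f x = g x) ->
  reduced_on r d f -> reduced_on r d g.
Proof. by move=> fg [p [ps pS]]; exists p; split=> // x Sx; rewrite -fg ?pS. Qed.

Lemma reduced_on_le r d d' f : (d <= d')%N -> reduced_on r d f -> reduced_on r d' f.
Proof.
move=> dd [p [ps pS]]; exists p; split=> // mu /ps/andP[-> h] /=.
exact: leq_trans h dd.
Qed.

Lemma reduced_on_poly r d (p : {mpoly K[n]}) :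
  (forall mu, mu \in msupp p -> reduced_on r d (fun x => 'X_[mu].@[c^~ x])) ->
  reduced_on r d (fun x => p.@[c^~ x]).
Proof.
move=> H; rewrite [p]mpolyE.
have : {in msupp p, forall mu, reduced_on r d (fun x => 'X_[mu].@[c^~ x])} by [].
elim: (msupp p) => [|m s IH] ms.
  exists 0; split=> [mu|x Sx]; first by rewrite msupp0.
  by rewrite big_nil.
apply: (@reduced_on_eq _ _ (fun x => p@_m * 'X_[m].@[c^~ x] +
   (\sum_(i <- s) p@_i *: 'X_[i]).@[c^~ x])) => [x _|].
  by rewrite big_cons mevalD mevalZ.
apply: reduced_onD; first by apply: reduced_onZ; apply: ms; rewrite mem_head.
by apply: IH => mu mus; apply: ms; rewrite inE mus orbT.
Qed.

Lemma reduced_on_monomial r :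
  (forall J : 'I_r -> 'I_n, injective J -> exists P : {mpoly K[r]},
     [/\ P != 0, (msize P <= e)%N & forall x, S x -> P.@[fun i => c (J i) x] = 0]) ->
  forall m : 'X_{1..n}, reduced_on r (mdeg m) (fun x => 'X_[m].@[c^~ x]).
Proof.
move=> H; apply: ltmwf => m IH; have [ml|] := boolP (few_large r m).
  exists 'X_[m]; split=> // mu; rewrite msuppX inE => /eqP->.
  by rewrite ml leqnn.
rewrite /few_large -leqNgt => rL.
pose J i := enum_val (widen_ord rL i).
have JI : injective J by move=> i j /enum_val_inj/(congr1 val)/= /val_inj.
have [P [P0 Pe PS]] := H _ JI.
have [|q [qm qS]] := rewrite_monomial JI P0 PS (m := m).
  move=> i; apply: leq_trans Pe _; have := enum_valP (widen_ord rL i).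
  by rewrite inE.
apply: (@reduced_on_eq _ _ (fun x => q.@[c^~ x])) => [x Sx|]; first by rewrite qS.
apply: reduced_on_poly => mu /qm mm; apply: (reduced_on_le _ (IH _ mm)).
exact/lemc_mdeg/ltW.
Qed.

Lemma card_few_large r d :
  (#|[set mu : 'X_{1..n < d.+1} | few_large r.+1 mu]%SET|
    <= n.+1 ^ r * e.+1 ^ n * d.+1 ^ r)%N.
Proof.
(* A monomial is recovered from its exponents capped at e, together with the
   positions (padded with None) and values of its at most r large ones. *)
pose code := ({ffun 'I_r -> option 'I_n} * {ffun 'I_n -> 'I_e.+1}
  * {ffun 'I_r -> 'I_d.+1})%type.
pose decode (z : code) : 'X_{1..n} := [multinom
  if [pick k | z.1.1 k == Some j] is Some k then z.2 k : nat else z.1.2 j | j < n].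
pose dec (z : code) : 'X_{1..n < d.+1} := insubd bm0 (decode z).
have -> : (n.+1 ^ r * e.+1 ^ n * d.+1 ^ r)%N = #|[set: code]%SET|.
  by rewrite cardsT !card_prod !card_ffun card_option !card_ord.
apply: leq_trans (leq_imset_card dec _); apply/subset_leq_card/fintype.subsetP => mu.
rewrite inE /few_large ltnS; set L := [set j | _]%SET => Lr.
pose z : code := ([ffun k : 'I_r => nth None (map Some (enum L)) k],
   [ffun j => inord (mu j)],
   [ffun k : 'I_r => inord (nth 0%N [seq mu j | j <- enum L] k)]).
have mud j : (mu j <= d)%N.
  by have := bmdeg mu; rewrite ltnS; apply: leq_trans; rewrite mdegE (bigD1 j) //= leq_addr.
apply/imsetP; exists z => //; apply: val_inj; rewrite val_insubd.
suff -> : decode z = mu by rewrite bmdeg.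
apply/mnmP => j; rewrite mnmE; case: pickP => [k|none] /=; rewrite ?ffunE.
  have [kL|kL] := ltnP k (size (enum L)); last by rewrite nth_default // size_map.
  rewrite (nth_map j) // => /eqP[<-]; rewrite (nth_map j) // inordK // ltnS.
  exact: mud.
have [jL|] := boolP (j \in L); last first.
  by rewrite inE -ltnNge => h; rewrite inordK // ltnW // ltnS ltnW.
have iL : (index j (enum L) < r)%N.
  by apply: leq_trans Lr; rewrite cardE index_mem mem_enum.
have := none (Ordinal iL); rewrite ffunE /= (nth_map j) ?index_mem ?mem_enum //.
by rewrite nth_index ?mem_enum // eqxx.
Qed.

End Counting.

(** * Dependence of quotients of polynomial functions *)

Lemma msizeM_deg (K : numFieldType) n (p q : {mpoly K[n]}) a b :
  (msize p <= a.+1)%N -> (msize q <= b.+1)%N -> (msize (p * q) <= (a + b).+1)%N.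
Proof.
move=> pa qb; rewrite msizeE; apply/bigmax_leqP_seq => mu.
move=> /msuppM_le/allpairsP[[x y] /= [xp yq ->]] _.
rewrite mdegD ltnS leq_add // -ltnS.
  exact: leq_trans (msize_mdeg_lt xp) pa.
exact: leq_trans (msize_mdeg_lt yq) qb.
Qed.

Lemma msizeX_deg (K : numFieldType) n (p : {mpoly K[n]}) a k :
  (msize p <= a.+1)%N -> (msize (p ^+ k) <= (k * a).+1)%N.
Proof.
move=> pa; elim: k => [|k IH]; first by rewrite expr0 msize1.
by rewrite exprS mulSn; exact: msizeM_deg.
Qed.

Lemma msize_prod_deg (K : numFieldType) n (I : Type) (s : seq I)
    (p : I -> {mpoly K[n]}) (a : I -> nat) :
  (forall i, msize (p i) <= (a i).+1)%N ->
  (msize (\prod_(i <- s) p i) <= (\sum_(i <- s) a i).+1)%N.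
Proof.
move=> pa; elim: s => [|i s IH]; first by rewrite !big_nil msize1.
by rewrite !big_cons; exact: msizeM_deg.
Qed.

(** A box of N ^ (r + 1) exponent vectors outnumbers the O(N ^ r) monomials that
    their products can involve. *)
Lemma pow_beats_growth c B r : exists2 N, (0 < N)%N &
  (c * (N * B) ^ r < N ^ r.+1)%N.
Proof.
exists (c * B ^ r).+1 => //.
by rewrite expnMn mulnCA expnSr ltn_pmul2l ?expn_gt0.
Qed.

Lemma left_kernel_vector (K : fieldType) m n (A : 'M[K]_(m, n)) :
  (n < m)%N -> exists2 u : 'rV[K]_m, u != 0 & u *m A = 0.
Proof.
move=> nm; have : kermx A != 0.
  rewrite -mxrank_eq0 mxrank_ker subn_eq0 -ltnNge.
  exact: leq_ltn_trans (rank_leq_col A) nm.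
case/rowV0Pn => u /sub_kermxP uA u0; by exists u.
Qed.

Section Quotients.
Variables (K : numFieldType) (T : Type) (S : set T) (n : nat).
Variable (c : 'I_n -> T -> K).

(** The functions prod_i g_i ^ a_i h ^ (N - a_i), for exponents a_i < N, have
    degree O(N). By [card_few_large] they span on S a space of dimension
    O(N ^ (r - 1)), while there are N ^ r of them; dividing a linear relation
    between them by h ^ (r N) gives a polynomial relation between the g_i / h. *)
Lemma alg_dep_quotients r (g : 'I_r -> {mpoly K[n]}) (h : {mpoly K[n]}) :
  (forall J : 'I_r -> 'I_n, injective J -> alg_dep S (fun i => c (J i))) ->
  alg_dep (S `&` [set x | h.@[c^~ x] != 0])
    (fun i x => (g i).@[c^~ x] / h.@[c^~ x]).
Proof.
case: r g => [|r] g H.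
  pose J (i : 'I_0) : 'I_n := False_rect _ (notF (ltn_ord i)).
  have [|P P0 PS] := H J; first by case.
  exists P => // x [/PS <- _]; by apply: meval_eq => -[].
(* One threshold e works for all of the finitely many tuples J. *)
have /choice[P PH] : forall J : {ffun 'I_r.+1 -> 'I_n}, exists Q : {mpoly K[r.+1]},
    injective J -> Q != 0 /\ forall x, S x -> Q.@[fun i => c (J i) x] = 0.
  move=> J; have [JI|nJ] := pselect (injective J); last by exists 0 => /nJ.
  by have [Q Q0 QS] := H _ JI; exists Q.
pose e := (\max_J msize (P J))%N.
have He (J : 'I_r.+1 -> 'I_n) : injective J -> exists P : {mpoly K[r.+1]},
    [/\ P != 0, (msize P <= e)%N & forall x, S x -> P.@[fun i => c (J i) x] = 0].
  move=> JI; pose J' := [ffun i => J i].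
  have J'I : injective J' by move=> i j; rewrite !ffunE => /JI.
  have [P0 PS] := PH _ J'I; exists (P J'); split=> // [|x /PS <-].
    exact: (@leq_bigmax _ (fun J : {ffun 'I_r.+1 -> 'I_n} => msize (P J)) J').
  by apply: meval_eq => i; rewrite ffunE.
pose D := maxn (msize h) (\max_i msize (g i))%N.
have hD : (msize h <= D.+1)%N by rewrite leqW // leq_maxl.
have gD i : (msize (g i) <= D.+1)%N.
  by rewrite leqW // leq_max (@leq_bigmax _ (fun i => msize (g i)) i) orbT.
have [N N0 NH] := pow_beats_growth (n.+1 ^ r * e.+1 ^ n) (r.+1 * (D + D)).+1 r.
pose M := (r.+1 * (N * (D + D)))%N.
pose F (al : {ffun 'I_r.+1 -> 'I_N}) : {mpoly K[n]} :=
  \prod_i (g i ^+ al i * h ^+ (N - al i)).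
have FM al : (msize (F al) <= M.+1)%N.
  have -> : M = (\sum_(i < r.+1) (N * (D + D)))%N by rewrite sum_nat_const card_ord.
  apply: msize_prod_deg => i; apply: leq_trans (msizeM_deg (msizeX_deg _ (gD i))
    (msizeX_deg _ hD)) _.
  rewrite ltnS mulnDr leq_add // leq_mul2r ?leq_subr ?orbT //.
  by rewrite ltnW ?orbT.
pose Gd := [set mu : 'X_{1..n < M.+1} | few_large e r.+1 mu]%SET.
have /choice[q qH] : forall al, reduced_on S c e r.+1 M (fun x => (F al).@[c^~ x]).
  move=> al; apply: reduced_on_poly => mu mus.
  apply: reduced_on_le (reduced_on_monomial He mu).
  by rewrite -ltnS; apply: leq_trans (FM al); exact: msize_mdeg_lt.
pose A := \matrix_(i < #|{ffun 'I_r.+1 -> 'I_N}|, j < #|Gd|)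
   (q (enum_val i))@_(enum_val j : 'X_{1..n < M.+1}).
have [|u u0 uA] := @left_kernel_vector _ _ _ A.
  rewrite card_ffun !card_ord; apply: leq_ltn_trans (card_few_large _ _ _ _) _.
  apply: leq_ltn_trans NH; rewrite leq_mul2l; apply/orP; right.
  have MN : (M.+1 <= N * (r.+1 * (D + D)).+1)%N.
    by rewrite mulnS addnC -addn1 leq_add // /M mulnCA.
  by case: (posnP r) => [->|r0]; rewrite ?expn0 // leq_exp2r.
pose mon (al : {ffun 'I_r.+1 -> 'I_N}) : 'X_{1..r.+1} := [multinom al i : nat | i < r.+1].
have monI : injective mon.
  move=> al be /mnmP E; apply/ffunP => i; apply: val_inj.
  by have := E i; rewrite !mnmE.
exists (\sum_i u ord0 i *: 'X_[mon (enum_val i)]).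
  have [i ui] : exists i, u ord0 i != 0.
    by have /rV0Pn[i ui] := u0; exists i.
  apply/eqP => /(congr1 (mcoeff (mon (enum_val i)))); rewrite raddf_sum /= mcoeff0.
  rewrite (bigD1 i) //= mcoeffZ mcoeffX eqxx mulr1 big1 ?addr0; first exact/eqP.
  move=> j ji; rewrite mcoeffZ mcoeffX (inj_eq monI) (inj_eq enum_val_inj).
  by rewrite (negPf ji) mulr0.
move=> x [Sx /= hx]; set hv := h.@[c^~ x] in hx *.
apply: (@mulfI _ (\prod_(i < r.+1) hv ^+ N)).
  by apply/prodf_neq0 => i _; rewrite expf_neq0.
rewrite mulr0 raddf_sum /= mulr_sumr.
transitivity (\sum_i u ord0 i * (q (enum_val i)).@[c^~ x]).
  apply: eq_bigr => i _; rewrite mevalZ mulrCA; congr (_ * _).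
  rewrite -(qH (enum_val i)).2 // mevalX -big_split /= rmorph_prod /=.
  apply: eq_bigr => k _; rewrite mnmE rmorphM !rmorphXn /= -/hv expr_div_n.
  rewrite mulrCA; congr (_ * _).
  have kN : (enum_val i k <= N)%N by rewrite ltnW.
  by rewrite -{1}(subnK kN) exprD mulfK // expf_neq0.
have qE al : (q al).@[c^~ x] =
    \sum_(j < #|Gd|) (q al)@_(enum_val j : 'X_{1..n < M.+1}) *
       'X_[enum_val j : 'X_{1..n < M.+1}].@[c^~ x].
  rewrite -(big_enum_val (fun mu : 'X_{1..n < M.+1} => (q al)@_mu * 'X_[mu].@[c^~ x])) /=.
  have [qs _] := qH al.
  rewrite {1}[q al](mpolywE (k := M.+1)); last first.
    rewrite msizeE; apply/bigmax_leqP_seq => mu mus _.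
    by rewrite ltnS; have /andP[] := qs _ mus.
  rewrite raddf_sum /= [RHS]big_mkcond /=; apply: eq_bigr => mu _.
  rewrite mevalZ inE; case: ifP => // /negbT nl.
  have -> : (q al)@_mu = 0; last by rewrite mul0r.
  by apply: memN_msupp_eq0; apply: contraNN nl => /qs/andP[].
under eq_bigr do rewrite qE mulr_sumr.
rewrite exchange_big /= big1 // => j _.
under eq_bigr do rewrite mulrA.
rewrite -mulr_suml [X in X * _](_ : _ = 0) ?mul0r //.
have /rowP/(_ j) := uA; rewrite !mxE => uAj; rewrite -[RHS]uAj; apply: eq_bigr => i _.
by rewrite !mxE.
Qed.

End Quotients.

(** * Independent functions on a larger set *)

Section Extend.
Variables (K : numFieldType) (T : Type) (n : nat) (v : T -> 'I_n -> K).

(** Write a relation between the w_i and p as p ^ a * Q with Q not divisible by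
    the last variable. The factor p ^ a cancels on B, so Q vanishes on A, where
    p = 0 leaves the relation Q(w, 0) = 0 between the w_i. The hypothesis on
    p ^ a * q holds when B is irreducible and contains A and p is not zero on B,
    and also when A lies in the closure of B and p vanishes nowhere on B. *)
Lemma alg_indep_extend (A B : set T) (p : {mpoly K[n]}) k (w : 'I_k -> {mpoly K[n]}) :
  (forall x, A x -> p.@[v x] = 0) ->
  (forall a q, (forall x, B x -> (p ^+ a * q).@[v x] = 0) ->
     forall x, A x -> q.@[v x] = 0) ->
  ~ alg_dep A (fun i x => (w i).@[v x]) ->
  ~ alg_dep B (fun i x => (oapp w p (unlift (@ord_max k) i)).@[v x]).
Proof.
move=> pA pB indep [P P0 PB]; apply: indep.
(* The exact power of the last variable dividing P. *)
have [a [b]] := multiplicity_XsubC (muni P) 0.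
have -> /= : muni P != 0 by apply: contra_neq P0; exact: muni_eq0.
rewrite subr0 => b0 Pb; exists b.[0]; first by rewrite -rootE.
pose phi := comp_mpoly [tuple w i | i < k].
pose Q := (map_poly phi b).[p].
have phiE x c : (phi c).@[v x] = c.@[fun i => (w i).@[v x]].
  by rewrite comp_mpoly_meval; apply: meval_eq => i; rewrite tnth_mktuple.
have QE x : Q.@[v x] = (map_poly (meval (fun i => (w i).@[v x])) b).[p.@[v x]].
  rewrite -horner_map /= -map_poly_comp /=; congr (_.[_]).
  by apply: eq_map_poly => c /=; rewrite phiE.
have widenK (i : 'I_k) : unlift ord_max (widen_ord (leqnSn _) i) = Some i.
  have -> : widen_ord (leqnSn _) i = lift ord_max i.
    by apply: val_inj; rewrite /= /bump leqNgt ltn_ord.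
  exact: liftK.
have PE x : P.@[fun i => (oapp w p (unlift (@ord_max k) i)).@[v x]] =
    (p ^+ a * Q).@[v x].
  rewrite -meval_muni Pb rmorphM rmorphXn /= map_polyX hornerM hornerXn.
  rewrite unlift_none /= mevalM rmorphXn /= QE mulrC; congr (_ * _.[_]).
  by apply: eq_map_poly => c; apply: meval_eq => i /=; rewrite widenK.
move=> x Ax; have QA : Q.@[v x] = 0.
  by apply: (pB a) Ax => y By; rewrite -PE PB.
by rewrite -[RHS]QA QE pA // !horner_coef0 coef_map.
Qed.

End Extend.

(** * Noetherianity of affine space *)

Lemma monotone_subseq (u : nat -> nat) :
  exists s : nat -> nat, {homo s : i j / (i < j)%N} /\
    {homo (fun i => u (s i)) : i j / (i <= j)%N}.
Proof.
have /choice[m mH] N : exists M, (N <= M)%N /\ forall i, (N <= i)%N -> (u M <= u i)%N.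
  have exm : exists k, `[< exists2 i, (N <= i)%N & u i = k >].
    by exists (u N); apply/asboolP; exists N.
  case: (ex_minnP exm) => k /asboolP[M NM <-] min; exists M; split=> // i Ni.
  by apply: min; apply/asboolP; exists i.
pose s := fix s k := if k is k'.+1 then m (s k').+1 else m 0%N.
have sS k : (s k < s k.+1)%N by have [] := mH (s k).+1.
have s_homo : {homo s : i j / (i < j)%N} by apply: homo_ltn => //; exact: ltn_trans.
exists s; split=> //; apply: homo_leq => // [y x z|k]; first exact: leq_trans.
case: k => [|k]; first by apply: (mH 0%N).2.
by apply: (mH (s k).+1).2; apply: ltn_trans (sS _) (sS _).
Qed.

Lemma dickson n (f : nat -> 'X_{1..n}) : exists i j, (i < j)%N /\ (f i <= f j)%MM.
Proof.
have H k : exists s : nat -> nat, {homo s : i j / (i < j)%N} /\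
    forall l : 'I_n, (l < k)%N -> {homo (fun i => f (s i) l) : i j / (i <= j)%N}.
  elim: k => [|k [s [s_homo sf]]]; first by exists id; split=> // l; rewrite ltn0.
  have [kn|nk] := ltnP k n; last first.
    exists s; split=> // l _; apply: sf; exact: leq_trans nk.
  have [t [t_homo tf]] := monotone_subseq (fun i => f (s i) (Ordinal kn)).
  exists (s \o t); split=> [i j ij|l]; first by apply: s_homo; apply: t_homo.
  rewrite ltnS leq_eqVlt => /orP[/eqP lk|lk] i j ij /=.
    by rewrite (_ : l = Ordinal kn) ?tf //; apply: val_inj.
  by apply: sf => //; move: ij; rewrite leq_eqVlt => /orP[/eqP->|/t_homo/ltnW].
have [s [s_homo sf]] := H n.
exists (s 0%N), (s 1%N); split; first exact: s_homo.
by apply/mnm_lepP => l; apply: sf.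
Qed.

Section Noetherian.
Variables (K : numFieldType) (n : nat).
Implicit Types (S : set ('I_n -> K)) (D : set {mpoly K[n]}).

Definition vanishing S : set {mpoly K[n]} := [set p | forall x, S x -> p.@[x] = 0].

Lemma vanishing_sub S S' : S `<=` S' -> vanishing S' `<=` vanishing S.
Proof. by move=> SS' p pS' x /SS'/pS'. Qed.

Lemma minimal_mlead D : D !=set0 ->
  exists2 p, D p & forall q, D q -> ~~ (mlead q < mlead p)%O.
Proof.
case=> p0 Dp0; apply: contrapT => nomin.
suff H m : forall p, D p -> mlead p <> m by exact: (H _ _ Dp0 erefl).
elim/(@ltmwf n): m => m IH p Dp pm; apply: nomin; exists p => // q Dq; apply/negP => qp.
by apply: (IH (mlead q) _ q Dq erefl); rewrite -pm.
Qed.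

(** Hilbert's basis theorem. In a strictly increasing chain choose f_k in the
    (k + 1)-st ideal but not in the k-th, with smallest leading monomial. By
    Dickson's lemma the leading monomial of some f_i divides that of a later
    f_j, and reducing f_j by f_i contradicts the choice of f_j. *)
Lemma vanishing_noetherian (S : nat -> set ('I_n -> K)) :
  (forall k, vanishing (S k) `<=` vanishing (S k.+1)) ->
  exists k, vanishing (S k.+1) `<=` vanishing (S k).
Proof.
move=> incr; apply: contrapT => noex.
have /choice[f fH] k : exists f, (vanishing (S k.+1) `\` vanishing (S k)) f /\
   forall q, (vanishing (S k.+1) `\` vanishing (S k)) q -> ~~ (mlead q < mlead f)%O.
  have [|f fD fmin] := @minimal_mlead (vanishing (S k.+1) `\` vanishing (S k)).
    apply/set0P/negP => /eqP; rewrite setD_eq0 => Sk; apply: noex.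
    by exists k.
  by exists f.
have homo i j : (i <= j)%N -> vanishing (S i) `<=` vanishing (S j).
  apply: (@homo_leq _ (fun k => vanishing (S k)) (fun A B => A `<=` B)) => //; first by move=> A p.
  by move=> B A C AB BC p /AB/BC.
have nz k : f k != 0.
  by have [[_ nf] _] := fH k; apply: contra_notN nf => /eqP-> x _; rewrite meval0.
have [i [j [ij le]]] := dickson (fun k => mlead (f k)).
have [[fi _] _] := fH i; have [[fj nfj] min] := fH j.
pose g : {mpoly K[n]} := 'X_[mlead (f j) - mlead (f i)] * f i.
have Xnz m : 'X_[m] != 0 :> {mpoly K[n]}.
  by rewrite -mleadc_eq0 mleadXm mcoeffX eqxx oner_neq0.
have g0 : g != 0 by rewrite mulf_neq0.
have glead : mlead g = mlead (f j).
  by rewrite mleadM // mleadXm submK.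
pose q := f j - (mleadc (f j) / mleadc g) *: g.
have gS k : (i < k)%N -> vanishing (S k) g.
  by move=> ik x Sx; rewrite mevalM (homo _ _ ik _ fi) // mulr0.
have nq : ~ vanishing (S j) q.
  apply: contra_not nfj => qS x Sx; have := qS x Sx.
  by rewrite mevalB mevalZ (gS _ ij) // mulr0 subr0.
have qD : (vanishing (S j.+1) `\` vanishing (S j)) q.
  by split=> // x Sx; rewrite mevalB mevalZ (gS _ (leqW ij)) // mulr0 subr0 fj.
have := min _ qD; apply/negP; rewrite negbK.
have q0 : q != 0 by apply: contra_notN nq => /eqP-> x _; rewrite meval0.
rewrite lt_neqAle; apply/andP; split.
  apply: contraNneq q0 => qlead; rewrite -mleadc_eq0 qlead mcoeffB mcoeffZ.
  by rewrite -glead divfK ?subrr // mleadc_eq0.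
apply: le_trans (mleadB_le _ _) _; rewrite leUx lexx /=.
by apply: le_trans (mleadZ_le _ _) _; rewrite glead.
Qed.

(** Minimality is expressed on vanishing ideals, so that the members of F need not
    be closed. *)
Lemma minimal_closed (F : set (set ('I_n -> K))) : F !=set0 ->
  exists2 S, F S & forall S', F S' -> S' `<=` S -> vanishing S' `<=` vanishing S.
Proof.
move=> [S0 FS0]; apply: contrapT => nomin.
have H (A : {S | F S}) : exists B : {S | F S}, sval B `<=` sval A /\
    ~ vanishing (sval B) `<=` vanishing (sval A).
  apply: contrapT => noB; apply: nomin; exists (sval A); first exact: (svalP A).
  move=> S' FS' S'A; apply: contrapT => nv; apply: noB.
  by exists (exist _ S' FS').
have [next nextH] := choice H.
pose s k := iter k next (exist _ S0 FS0).
have [k|k kH] := @vanishing_noetherian (fun k => sval (s k)).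
  by apply: vanishing_sub; exact: (nextH _).1.
exact: (nextH (s k)).2.
Qed.

End Noetherian.

(** * Images of locally closed sets under coordinate projections *)

Section Projection.
Variable K : numClosedFieldType.

Definition env k (u : 'I_k -> K) : seq K := [seq u i | i <- enum 'I_k].

Lemma nth_env k (u : 'I_k -> K) (i : 'I_k) : (env u)`_i = u i.
Proof. by rewrite (nth_map i) ?size_enum_ord // nth_ord_enum. Qed.

Lemma rterm_mpoly k (t : GRing.term K) : GRing.rterm t ->
  exists p : {mpoly K[k]}, forall u, GRing.eval (env u) t = p.@[u].
Proof.
elim: t => //=.
- move=> i _; have [ik|ki] := ltnP i k.
    by exists 'X_(Ordinal ik) => u; rewrite mevalXU -nth_env.
  by exists 0 => u; rewrite meval0 nth_default // size_map size_enum_ord.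
- by move=> c _; exists c%:MP => u; rewrite mevalC.
- by move=> i _; exists (i%:R) => u; rewrite rmorph_nat.
- move=> t1 IH1 t2 IH2 /andP[/IH1[p pE] /IH2[q qE]]; exists (p + q) => u.
  by rewrite mevalD pE qE.
- by move=> t IH /IH[p pE]; exists (- p) => u; rewrite mevalN pE.
- by move=> t IH i /IH[p pE]; exists (p *+ i) => u; rewrite mevalMn pE.
- move=> t1 IH1 t2 IH2 /andP[/IH1[p pE] /IH2[q qE]]; exists (p * q) => u.
  by rewrite mevalM pE qE.
- by move=> t IH i /IH[p pE]; exists (p ^+ i) => u; rewrite rmorphXn /= pE.
Qed.

(** Each equation in a quantifier-free formula either holds identically or fails
    where its difference is nonzero, so the truth value is constant on a
    principal open set. *)
Lemma qf_eval_generic k (f : GRing.formula K) : GRing.qf_form f -> GRing.rformula f ->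
  exists2 q : {mpoly K[k]}, q != 0 &
  exists b, forall u, q.@[u] != 0 -> GRing.qf_eval (env u) f = b.
Proof.
have two f1 f2 (op : bool -> bool -> bool) :
    (exists2 q : {mpoly K[k]}, q != 0 &
      exists b, forall u, q.@[u] != 0 -> GRing.qf_eval (env u) f1 = b) ->
    (exists2 q : {mpoly K[k]}, q != 0 &
      exists b, forall u, q.@[u] != 0 -> GRing.qf_eval (env u) f2 = b) ->
    (exists2 q : {mpoly K[k]}, q != 0 & exists b, forall u, q.@[u] != 0 ->
       op (GRing.qf_eval (env u) f1) (GRing.qf_eval (env u) f2) = b).
  move=> [q1 q10 [b1 H1]] [q2 q20 [b2 H2]]; exists (q1 * q2); first exact: mulf_neq0.
  exists (op b1 b2) => u; rewrite mevalM mulf_eq0 negb_or => /andP[/H1-> /H2->//].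
elim: f => //=.
- by move=> b _ _; exists 1; [exact: oner_neq0|exists b].
- move=> t1 t2 _ /andP[/(rterm_mpoly k)[p pE] /(rterm_mpoly k)[q qE]].
  have [pq|pq] := eqVneq p q.
    exists 1; first exact: oner_neq0.
    by exists true => u _; rewrite pE qE pq eqxx.
  exists (p - q); first by rewrite subr_eq0.
  by exists false => u; rewrite mevalB subr_eq0 pE qE => /negbTE.
- by move=> f1 IH1 f2 IH2 /andP[q1 q2] /andP[r1 r2]; apply: (two _ _ andb); auto.
- by move=> f1 IH1 f2 IH2 /andP[q1 q2] /andP[r1 r2]; apply: (two _ _ orb); auto.
- by move=> f1 IH1 f2 IH2 /andP[q1 q2] /andP[r1 r2]; apply: (two _ _ implb); auto.
- move=> f IH qf rf; have [q q0 [b H]] := IH qf rf; exists q => //.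
  by exists (~~ b) => u /H->.
Qed.

(** The variables X_i of p become the first-order variables numbered s + i. *)
Definition mpoly_term n (s : nat) (p : {mpoly K[n]}) : GRing.term K :=
  foldr (fun m t => GRing.Add (GRing.Mul (GRing.Const p@_m)
     (foldr (fun (i : 'I_n) t' => GRing.Mul (GRing.Exp (GRing.Var _ (s + i)) (m i)) t')
        (GRing.NatConst _ 1) (enum 'I_n))) t) (GRing.NatConst _ 0) (msupp p).

Lemma mpoly_term_rterm n s (p : {mpoly K[n]}) : GRing.rterm (mpoly_term s p).
Proof.
rewrite /mpoly_term; elim: (msupp p) => //= m ms ->; rewrite andbT.
by elim: (enum 'I_n).
Qed.

Lemma eval_mpoly_term n s (p : {mpoly K[n]}) e :
  GRing.eval e (mpoly_term s p) = p.@[fun i => e`_(s + i)].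
Proof.
rewrite mevalE /mpoly_term; elim: (msupp p) => [|m ms IH] /=; first by rewrite big_nil.
rewrite big_cons IH; congr (_ * _ + _).
rewrite -[in RHS]big_enum /=.
by elim: (enum 'I_n) => [|i l IHl] /=; rewrite ?big_nil // big_cons IHl.
Qed.

Lemma holds_conjunction (A : eqType) (F : A -> GRing.formula K) (l : seq A) e :
  GRing.holds e (foldr (fun x => GRing.And (F x)) (GRing.Bool true) l) <->
  {in l, forall x, GRing.holds e (F x)}.
Proof.
elim: l => //= x l IH; split=> [[Fx /IH Fl] y|H].
  by rewrite inE => /orP[/eqP->//|/Fl].
by split; [apply: H; rewrite mem_head|apply/IH => y yl; apply: H; rewrite inE yl orbT].
Qed.

(** Chevalley's theorem in the form that is used: the image of a locally closed
    set under coordinates J either contains or misses a nonempty open set. The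
    first-order variables 0, .., k - 1 are the target coordinates u, and the next
    n of them, which are quantified, are the coordinates of the point w. *)
Lemma projection_generic n k (G : seq {mpoly K[n]}) (g : {mpoly K[n]})
    (J : 'I_k -> 'I_n) :
  exists2 q : {mpoly K[k]}, q != 0 &
  exists b : bool, forall u, q.@[u] != 0 ->
    b <-> exists w, [/\ forall p, p \in G -> p.@[w] = 0, g.@[w] != 0 &
                        forall i, w (J i) = u i].
Proof.
pose eqn (p : {mpoly K[n]}) := GRing.Equal (mpoly_term k p) (GRing.NatConst _ 0).
pose fibn (i : 'I_k) := GRing.Equal (GRing.Var K (k + J i)) (GRing.Var _ i).
pose eqs := foldr (fun p => GRing.And (eqn p)) (GRing.Bool true) G.
pose fib := foldr (fun i => GRing.And (fibn i)) (GRing.Bool true) (enum 'I_k).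
pose body := GRing.And eqs (GRing.And
  (GRing.Not (eqn g)) fib).
pose phi := foldr (@GRing.Exists K) body (iota k n).
have rphi : GRing.rformula phi.
  rewrite /phi; elim: (iota k n) => //=; rewrite mpoly_term_rterm /=; apply/andP; split.
    by rewrite /eqs; elim: (G) => //= p l ->; rewrite mpoly_term_rterm.
  by rewrite /fib; elim: (enum 'I_k).
have bodyE e : GRing.holds e body <-> [/\ forall p, p \in G -> p.@[fun i : 'I_n => e`_(k + i)] = 0,
    g.@[fun i : 'I_n => e`_(k + i)] != 0 & forall i : 'I_k, e`_(k + J i) = e`_i].
  have eqsE : GRing.holds e eqs <-> forall p, p \in G -> p.@[fun i : 'I_n => e`_(k + i)] = 0.
    apply: iff_trans (holds_conjunction _ _ _) _.
    by split=> H p /H; rewrite /= eval_mpoly_term.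
  have fibE : GRing.holds e fib <-> forall i : 'I_k, e`_(k + J i) = e`_i.
    apply: iff_trans (holds_conjunction _ _ _) _.
    by split=> H i; [apply: H; rewrite mem_enum|move=> _; exact: H].
  rewrite /body /= eval_mpoly_term; split.
    by move=> [/eqsE ? [/eqP ? /fibE ?]].
  by move=> [/eqsE ? /eqP ? /fibE ?].
have := GRing.quantifier_elim_wf (@closed_field.ClosedFieldQE.wf_ex_elim K) rphi.
have QE e := GRing.quantifier_elim_rformP (@closed_field.ClosedFieldQE.wf_ex_elim K)
  (closed_field.ClosedFieldQE.holds_ex_elim (@solve_monicpoly K)) e rphi.
move=> /andP[qf rf]; have [q q0 [b qb]] := qf_eval_generic k qf rf.
exists q => //; exists b => u /qb <-; split.
  move/QE/GRing.foldExistsP => [e ee /bodyE[eG eg eJ]].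
  exists (fun i : 'I_n => e`_(k + i)); split=> // i.
  rewrite eJ -(nth_env u); apply/esym/ee.
  by rewrite !inE mem_iota negb_and -ltnNge ltn_ord.
move=> [w [wG wg wJ]]; apply/QE/GRing.foldExistsP.
have szu : size (env u) = k by rewrite size_map size_enum_ord.
have wE (i : 'I_n) : (env u ++ env w)`_(k + i) = w i.
  by rewrite nth_cat szu ltnNge leq_addr /= addKn nth_env.
have uE (i : 'I_k) : (env u ++ env w)`_i = u i.
  by rewrite nth_cat szu ltn_ord nth_env.
exists (env u ++ env w).
  move=> i; rewrite !inE mem_iota negb_and -ltnNge -leqNgt => /orP[ik|nki].
    by rewrite nth_cat szu ik.
  rewrite !nth_default // ?size_cat szu; last exact: leq_trans (leq_addr _ _) nki.
  by rewrite size_map size_enum_ord.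
apply/bodyE; split=> [p /wG pw||i]; last by rewrite wE uE.
  by rewrite -[RHS]pw; exact: meval_eq.
by rewrite (@meval_eq _ _ _ w).
Qed.

End Projection.

(** * Chains of irreducible subsets of affine space *)

Section AffineChains.
Variables (K : numClosedFieldType) (n : nat).
Implicit Types (G : set {mpoly K[n]}) (g p q : {mpoly K[n]}) (S : set ('I_n -> K)).

Definition locally_closed G g : set ('I_n -> K) :=
  [set w | (forall p, G p -> p.@[w] = 0) /\ g.@[w] != 0].

Definition poly_irreducible S :=
  S !=set0 /\ forall p q, vanishing S (p * q) -> vanishing S p \/ vanishing S q.

Lemma finitely_many_equations G : exists s : seq {mpoly K[n]},
  (forall p, p \in s -> G p) /\
  forall w, (forall p, p \in s -> p.@[w] = 0) -> forall p, G p -> p.@[w] = 0.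
Proof.
pose V (s : seq {mpoly K[n]}) := [set w : 'I_n -> K | forall p, p \in s -> p.@[w] = 0].
have [|S [s sG <-] min] := @minimal_closed K n
    [set V s | s in [set s : seq {mpoly K[n]} | forall p, p \in s -> G p]].
  by exists (V [::]), [::].
exists s; split=> // w sw p Gp.
apply: (min (V (p :: s)) _ _ p) => //.
- by exists (p :: s) => // q; rewrite inE => /orP[/eqP->//|/sG].
- by move=> y Vy q qs; apply: Vy; rewrite inE qs orbT.
- by move=> y; apply; rewrite mem_head.
Qed.

(** Take a minimal closed subset on which the J-coordinates are independent. If
    pq = 0 on it, they are independent on its part p = 0 or on its part q = 0,
    which must then be everything. *)
Lemma minimal_independent k (J : 'I_k -> 'I_n) G g :
  ~ alg_dep (locally_closed G g) (fun i w => w (J i)) ->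
  exists G', [/\ locally_closed G' g `<=` locally_closed G g, poly_irreducible (locally_closed G' g) &
    ~ alg_dep (locally_closed G' g) (fun i w => w (J i))].
Proof.
move=> ind; pose good S := S `<=` locally_closed G g /\ ~ alg_dep S (fun i w => w (J i)).
have [|_ [G' [G'G G'ind] <-] min] := @minimal_closed K n
    [set locally_closed G' g | G' in [set G' | good (locally_closed G' g)]].
  by exists (locally_closed G g), G => //; split.
exists G'; split=> //; split=> [|p q pq].
  apply: contrapT => empty; apply: G'ind; exists 1; first exact: oner_neq0.
  by move=> w Gw; case: empty; exists w.
have cut r : ~ alg_dep (locally_closed (r |` G') g) (fun i w => w (J i)) ->
    vanishing (locally_closed G' g) r.
  move=> rind; have sub : locally_closed (r |` G') g `<=` locally_closed G' g.
    by move=> w [rw gw]; split=> // s Gs; apply: rw; right.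
  apply: (min _ _ sub); last by move=> w [rw _]; apply: rw; left.
  by exists (r |` G') => //; split=> //; exact: subset_trans sub G'G.
have [pd|/cut] := pselect (alg_dep (locally_closed (p |` G') g) (fun i w => w (J i))); last by left.
have [qd|/cut] := pselect (alg_dep (locally_closed (q |` G') g) (fun i w => w (J i))); last by right.
case: G'ind; apply: alg_dep_sub (alg_depU pd qd) => w [Gw gw].
have /eqP := pq w (conj Gw gw); rewrite mevalM mulf_eq0 => /orP[] /eqP e; [left|right];
  by split=> // s [->|/Gw].
Qed.

(** The image of the set under J contains the locus q <> 0. Fixing the last
    coordinate to a value a for which q(.., a) is not identically zero keeps the
    locus q(.., a) <> 0 in the image of the section, so the other coordinates
    stay independent on it. *)
Lemma hyperplane_section k (J : 'I_k.+1 -> 'I_n) G g :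
  ~ alg_dep (locally_closed G g) (fun i w => w (J i)) ->
  exists G' a, [/\ locally_closed G' g `<=` locally_closed G g, poly_irreducible (locally_closed G' g),
    forall w, locally_closed G' g w -> w (J ord_max) = a &
    ~ alg_dep (locally_closed G' g) (fun i w => w (J (lift ord_max i)))].
Proof.
move=> ind; have [s [sG Gs]] := finitely_many_equations G.
have [q q0 [b qb]] := projection_generic s g J.
have bT : b.
  apply: contrapT => nb; apply: ind; exists q => // w [Gw gw].
  apply/eqP; apply: contrapT => /negP qw; apply: nb; apply/qb; first exact: qw.
  by exists w; split=> // p /sG/Gw.
have [a0 qa0] := mpoly_nonroot q0; pose a := a0 ord_max.
pose ext (u : 'I_k -> K) (i : 'I_k.+1) := oapp u a (unlift ord_max i).
pose qa := q \mPo [tuple oapp (fun j => 'X_j) a%:MP (unlift ord_max i) | i < k.+1].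
have qaE u : qa.@[u] = q.@[ext u].
  rewrite comp_mpoly_meval; apply: meval_eq => i; rewrite tnth_mktuple /ext.
  by case: unlift => [j|] /=; rewrite ?mevalXU ?mevalC.
have qan0 : qa != 0.
  apply: contra_neq qa0 => qa0; have := qaE (fun j => a0 (lift ord_max j)).
  rewrite qa0 meval0 => ->; apply: meval_eq => i; rewrite /ext.
  by case: unliftP => [j|] ->.
pose G0 := ('X_(J ord_max) - a%:MP) |` G.
have G0E w : locally_closed G0 g w <-> locally_closed G g w /\ w (J ord_max) = a.
  split=> [[G0w gw]|[[Gw gw] wa]]; split=> //.
  - by split=> // p Gp; apply: G0w; right.
  - apply/eqP; rewrite -subr_eq0 -(mevalXU w) -(mevalC w a) -mevalB.
    by apply/eqP/G0w; left.
  - by move=> p [->|/Gw//]; rewrite mevalB mevalXU mevalC wa subrr.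
have [|G' [G'G0 G'irr G'ind]] := @minimal_independent _ (fun i => J (lift ord_max i)) G0 g.
  move=> [P P0 PG]; have [u] := mpoly_nonroot (mulf_neq0 P0 qan0).
  rewrite mevalM mulf_eq0 negb_or qaE => /andP[Pu /qb/iffLR/(_ bT)[w [ws wg wJ]]].
  have wa : w (J ord_max) = a by rewrite wJ /ext unlift_none.
  have w0 : locally_closed G0 g w by apply/G0E; split=> //; split=> // p Gp; exact: Gs Gp.
  have := PG w w0; apply/eqP; apply: contra_neq Pu => <-; apply: meval_eq => i.
  by rewrite wJ /ext liftK.
by exists G', a; split=> // w /G'G0/G0E[].
Qed.

Lemma affine_chain k (J : 'I_k -> 'I_n) G g :
  poly_irreducible (locally_closed G g) -> ~ alg_dep (locally_closed G g) (fun i w => w (J i)) ->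
  exists D : nat -> set {mpoly K[n]}, [/\ D k = G,
    forall i, (i <= k)%N -> poly_irreducible (locally_closed (D i) g) &
    forall i, (i < k)%N -> locally_closed (D i) g `<` locally_closed (D i.+1) g].
Proof.
elim: k J G => [|k IH] J G irr ind.
  by exists (fun=> G); split=> // i; rewrite leqn0 => /eqP->.
have [G' [a [G'G G'irr G'a G'ind]]] := hyperplane_section ind.
have [D [Dk Dirr Dlt]] := IH _ _ G'irr G'ind.
exists (fun i => if (i <= k)%N then D i else G); split=> [|i|i].
- by rewrite ltnn.
- by case: ifP => // ik _; exact: Dirr.
rewrite ltnS => ik1; have [ik|ki] := ltnP i k; first by rewrite ik1; exact: Dlt.
have -> : i = k by apply/eqP; rewrite eqn_leq ik1.
rewrite leqnn Dk properEneq; split=> //; apply/eqP => E; apply: ind.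
by apply: (alg_dep_const (i := ord_max) (c := a)) => w; rewrite -E; exact: G'a.
Qed.

End AffineChains.

(** * Affine charts of a topological space *)

Section Charts.
Variables (K : numClosedFieldType) (n : nat) (T : topologicalType).

(** O is open and carries the topology induced by v from the Zariski topology of
    affine space: the first clause says that v is continuous on O, the second that
    closed sets are cut out there by polynomials in v. *)
Definition affine_chart (O : set T) (v : T -> 'I_n -> K) : Prop :=
  (forall p : {mpoly K[n]}, open (O `&` [set x | p.@[v x] != 0])) /\
  (forall (A : set T) x, closed A -> O x -> ~ A x -> exists2 p : {mpoly K[n]},
     p.@[v x] != 0 & forall y, A y -> O y -> p.@[v y] = 0).

Variables (O : set T) (v : T -> 'I_n -> K).
Hypothesis chartO : affine_chart O v.

Lemma chart_closure (S : set T) (p : {mpoly K[n]}) :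
  (forall x, S x -> O x -> p.@[v x] = 0) ->
  forall x, closure S x -> O x -> p.@[v x] = 0.
Proof.
move=> pS x Sx Ox; apply/eqP; apply: contrapT => /negP px.
have [y [Sy [Oy /eqP]]] := Sx _ (open_nbhs_nbhs (conj (chartO.1 p) (conj Ox px))).
by apply; exact: pS.
Qed.

Lemma irreducible_sub_open (S : set T) (p q : {mpoly K[n]}) : irreducible S ->
  (forall x, S x -> O x -> (p * q).@[v x] = 0) ->
  (forall x, S x -> O x -> p.@[v x] = 0) \/ (forall x, S x -> O x -> q.@[v x] = 0).
Proof.
move=> [_ irrS] pq; pose N r := ~` (O `&` [set x | r.@[v x] != 0]).
have cN r : closed (N r) by apply: open_closedC; exact: chartO.1.
have [x Sx|Sp|Sq] := irrS _ _ (cN p) (cN q).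
- have [Ox|nO] := pselect (O x); last by left => -[].
  have /eqP := pq x Sx Ox; rewrite mevalM mulf_eq0 => /orP[] /eqP e; [left|right];
    by move=> [_ /=]; rewrite e eqxx.
- left=> x Sx Ox; apply/eqP; apply: contrapT => /negP e.
  by apply: (Sp x Sx).
- right=> x Sx Ox; apply/eqP; apply: contrapT => /negP e.
  by apply: (Sq x Sx).
Qed.

(** Each strict inclusion C_i < C_(i+1) provides a polynomial vanishing on C_i but
    not on C_(i+1), to which [alg_indep_extend] applies. Working in one chart is
    enough, because x0 belongs to all the C_i. *)
Lemma chain_independent (S : set T) k (C : nat -> set T) x0 :
  irreducible_chain S k C -> C 0%N x0 -> O x0 ->
  exists w : 'I_k -> {mpoly K[n]},
    ~ alg_dep (C k `&` O) (fun i x => (w i).@[v x]).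
Proof.
move=> [Cirr Clt] Cx0 Ox0.
have C0 i : (i <= k)%N -> C i x0.
  by elim: i => // i IH ik; apply: (Clt i ik).1; apply: IH; exact: ltnW.
suff H i : (i <= k)%N -> exists w : 'I_i -> {mpoly K[n]},
    ~ alg_dep (C i `&` O) (fun i x => (w i).@[v x]) by exact: H.
elim: i => [_|i IH ik].
  by exists (fun=> 0); apply: alg_indep0; exists x0; split=> //; exact: C0.
have [w ind] := IH (ltnW ik).
have [irr1 [A cA CA]] := Cirr _ ik; have [irr0 [B cB CB]] := Cirr _ (ltnW ik).
have [sub nsub] := Clt _ ik.
(* Otherwise C_(i+1), being irreducible, would lie in B or avoid the chart. *)
have [y [Cy Oy nBy]] : exists y, [/\ C i.+1 y, O y & ~ B y].
  apply: contrapT => noy; have [||CB'|CO] := irr1.2 _ (~` O) cB.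
  - apply: open_closedC; have := chartO.1 1; congr open.
    by apply/seteqP; split=> [y []//|y Oy]; split=> //=; rewrite meval1 oner_neq0.
  - move=> y Cy; have [Oy|] := pselect (O y); last by right.
    by left; apply: contrapT => nBy; apply: noy; exists y.
  - apply: nsub => y Cy; rewrite CB; split; last exact: CB'.
    by move: Cy; rewrite CA => -[].
  - by apply: (CO x0) => //; exact: C0.
have [p py pB] := chartO.2 _ _ cB Oy nBy.
exists (fun j => oapp w p (unlift ord_max j)).
apply: (alg_indep_extend _ _ ind) => [x [Cx Ox]|a q pq x [Cx Ox]].
  by apply: pB => //; move: Cx; rewrite CB => -[].
have pne : ~ forall x, C i.+1 x -> O x -> p.@[v x] = 0.
  by move=> /(_ y Cy Oy)/eqP; exact/negP.
suff : forall x, C i.+1 x -> O x -> q.@[v x] = 0 by apply => //; exact: sub.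
elim: a pq => [|a IHa] pq.
  by move=> z Cz Oz; rewrite -[RHS](pq z) ?expr0 ?mul1r.
apply: IHa => z [Cz Oz].
have [] // := @irreducible_sub_open _ p (p ^+ a * q) irr1 => [z' Cz' Oz'|/(_ z)]; last exact.
by rewrite mulrA -exprS pq.
Qed.

(** The closures in Z of the preimages are irreducible, and they stay distinct
    because a preimage is recovered from its closure by intersecting with g <> 0
    in the chart. *)
Lemma chain_of_affine_chain (Z : set T) k (D : nat -> set {mpoly K[n]}) g :
  (forall i, (i <= k)%N -> poly_irreducible (locally_closed (D i) g)) ->
  (forall i, (i < k)%N -> locally_closed (D i) g `<` locally_closed (D i.+1) g) ->
  (forall i w, (i <= k)%N -> locally_closed (D i) g w -> exists2 y, O y /\ Z y & v y = w) ->
  exists C, irreducible_chain Z k C.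
Proof.
move=> Dirr Dlt onto.
pose C' i := O `&` Z `&` [set y | locally_closed (D i) g (v y)].
exists (fun i => Z `&` closure (C' i)).
have C'C i : C' i `<=` Z `&` closure (C' i).
  by move=> y C'y; split; [case: C'y => -[]|exact: subset_closure].
split=> i ik.
  have [[w0 Dw0] irr] := Dirr i ik.
  split; last by exists (closure (C' i)); [exact: closed_closure|].
  split.
    have [y0 [Oy0 Zy0] vy0] := onto i w0 ik Dw0.
    by exists y0; apply: C'C; split=> //=; rewrite vy0.
  move=> A B cA cB AB.
  have cut E : closed E -> C' i `<=` E -> Z `&` closure (C' i) `<=` E.
    by move=> cE C'E y [_ Cy]; rewrite closure_id in cE; rewrite cE; exact: closureS Cy.
  have [C'A|nA] := pselect (C' i `<=` A); first by left; exact: cut.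
  have [C'B|nB] := pselect (C' i `<=` B); first by right; exact: cut.
  have sep E : closed E -> ~ C' i `<=` E -> exists y p,
      [/\ C' i y, p.@[v y] != 0 & forall z, E z -> O z -> p.@[v z] = 0].
    move=> cE /existsNP[y /not_implyP[Cy nEy]].
    have [p py pE] := chartO.2 _ _ cE Cy.1.1 nEy.
    by exists y, p.
  have [y [p [Cy py pA]]] := sep _ cA nA; have [z [q [Cz qz qB]]] := sep _ cB nB.
  exfalso; have [|pv|qv] := irr p q.
  - move=> w Dw; have [t [Ot Zt] vt] := onto i w ik Dw.
    have C't : C' i t by split=> //=; rewrite vt.
    rewrite -vt mevalM; have [/pA->//|/qB->//] := AB _ (C'C _ _ C't).
      by rewrite mul0r.
    by rewrite mulr0.
  - by move: py; rewrite pv ?eqxx //; exact: Cy.2.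
  - by move: qz; rewrite qv ?eqxx //; exact: Cz.2.
have [sub nsub] := Dlt i ik.
split.
  move=> y [Zy Cy]; split=> //; apply: closureS Cy => z [OZ Dz]; split=> //.
  exact: sub.
move=> CC; apply: nsub => w Dw; have [y [Oy Zy] vy] := onto _ _ ik Dw.
have C'y : C' i.+1 y by split=> //=; rewrite vy.
have [_ Cy] := CC _ (C'C _ _ C'y).
split; last exact: Dw.2.
move=> p Dp; rewrite -vy; apply: (chart_closure _ Cy Oy) => z [_ [Dz _]] _.
exact: Dz.
Qed.

(** The equations G1 cut out the image v(O). Near a point of Z in the chart, a
    principal open set g <> 0 lies inside U, so Z is there the preimage of a
    locally closed subset of affine space; by irreducibility of Z nothing is lost
    by restricting to it. *)
Lemma chain_of_independent_coordinates (Z A U : set T) (G1 : set {mpoly K[n]}) k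
    (J : 'I_k -> 'I_n) :
  closed A -> open U -> Z = A `&` U -> irreducible Z ->
  (forall w, (forall p, G1 p -> p.@[w] = 0) -> exists2 y, O y & v y = w) ->
  (forall y p, O y -> G1 p -> p.@[v y] = 0) ->
  ~ alg_dep (Z `&` O) (fun i x => v x (J i)) ->
  exists C, irreducible_chain Z k C.
Proof.
move=> cA oU ZE irrZ surj G1O ind.
have [x0 [Zx0 Ox0]] : (Z `&` O) !=set0.
  apply: contrapT => empty; apply: ind; exists 1; first exact: oner_neq0.
  by move=> x ZOx; case: empty; exists x.
have [|g gx0 gU] := chartO.2 (~` U) x0 (open_closedC oU) Ox0.
  by move: Zx0; rewrite ZE => -[_ Ux0] /(_ Ux0).
pose G := G1 `|` [set p | forall y, A y -> O y -> p.@[v y] = 0].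
have onto w : locally_closed G g w -> exists2 y, O y /\ Z y & v y = w.
  move=> [Gw gw]; have [|y Oy vy] := surj w; first by move=> p G1p; apply: Gw; left.
  exists y => //; split=> //; rewrite ZE; split; apply: contrapT => ny.
    have [p py pA] := chartO.2 _ _ cA Oy ny.
    by move: py; rewrite vy Gw ?eqxx //; right.
  by move: gw; rewrite -vy gU ?eqxx.
have inG y : Z y -> O y -> g.@[v y] != 0 -> locally_closed G g (v y).
  rewrite ZE => -[Ay _] Oy gy; split=> // p [G1p|pA]; last exact: pA.
  exact: G1O.
have cancelg p : vanishing (locally_closed G g) p -> forall x, Z x -> O x -> p.@[v x] = 0.
  move=> pG; have [||/(_ x0 Zx0 Ox0)/eqP gx0'] := irreducible_sub_open irrZ (p := p) (q := g).
  - move=> x Zx Ox; rewrite mevalM; have [->|gx] := eqVneq (g.@[v x]) 0.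
      by rewrite mulr0.
    by rewrite pG ?mul0r //; exact: inG.
  - by [].
  - by rewrite (negPf gx0) in gx0'.
have irr : poly_irreducible (locally_closed G g).
  split=> [|p q /cancelg pq]; first by exists (v x0); exact: inG.
  have [H|H] := irreducible_sub_open irrZ pq; [left|right];
    by move=> w /onto[y [Oy Zy] <-]; exact: H.
have [|D [Dk Dirr Dlt]] := @affine_chain _ _ _ J _ _ irr.
  move=> [P P0 PG]; apply: ind; exists P => // x [Zx Ox].
  have evJ w : P.@[fun i => w (J i)] = (P \mPo [tuple 'X_(J i) | i < k]).@[w].
    by rewrite comp_mpoly_meval; apply: meval_eq => i; rewrite tnth_mktuple mevalXU.
  by rewrite (evJ (v x)); apply: cancelg => // w Gw; rewrite -evJ PG.
have sub l i : (i + l = k)%N -> locally_closed (D i) g `<=` locally_closed G g.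
  elim: l i => [|l IH] i il; first by rewrite addn0 in il; rewrite il Dk.
  have ik : (i < k)%N by rewrite -il addnS ltnS leq_addr.
  by apply: subset_trans (Dlt i ik).1 (IH _ _); rewrite addSnnS.
by apply: (chain_of_affine_chain Dirr Dlt) => i w ik /(sub _ _ (subnKC ik)); exact: onto.
Qed.

End Charts.

(** * Homogeneous coordinates *)

Lemma homog_scale (K : fieldType) n e (p : {mpoly K[n]}) (c : K) u :
  p \is e.-homog -> p.@[fun i => c * u i] = c ^+ e * p.@[u].
Proof.
move=> /dhomogP ph; rewrite !mevalE mulr_sumr; apply: eq_big_seq => m /ph me.
rewrite mulrCA; congr (_ * _); rewrite -me /= mdegE -prodrXr -big_split /=.
by apply: eq_bigr => i _; rewrite exprMn.
Qed.

Section ProjectiveSpace.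
Variables (K : numClosedFieldType) (m : nat).
Implicit Types (z : projspace K m).

Lemma proj_basic_open (B : set (projspace K m)) : proj_basic B -> open B.
Proof. by move=> hB; exists [set B]; [move=> _ ->|rewrite bigcup_set1]. Qed.

Lemma open_proj_basic (A : set (projspace K m)) z :
  open A -> A z -> exists2 B, proj_basic B & B z /\ B `<=` A.
Proof.
by move=> [D DB <-] [B DBB Bz]; exists B; [exact: DB|split=> // y By; exists B].
Qed.

Lemma hcoord_neq0 z : exists j, hcoord z j != 0.
Proof. by have /rV0Pn := valP (repr z). Qed.

Lemma point_with_coordinates (a : 'I_m.+1 -> K) : (exists j, a j != 0) ->
  exists z : projspace K m, exists2 c, c != 0 & forall i, hcoord z i = c * a i.
Proof.
move=> [j aj]; pose u := \row_i a i.
have u0 : u != 0 by apply/rV0Pn; exists j; rewrite mxE.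
pose U : nzvec K m := exist _ u u0.
exists (\pi_(projspace K m) U)%qT.
have /andP[_ /sub_rVP[c uE]] : (val (repr (\pi_(projspace K m) U)%qT) == u)%MS.
  have : same_line (repr (\pi_(projspace K m) U)%qT) U by apply/eqmodP; rewrite reprK.
  by [].
have c0 : c != 0 by apply/eqP => c0; move: (u0); rewrite uE c0 scale0r eqxx.
exists c^-1 => [|i]; first by rewrite invr_eq0.
have := congr1 (fun r : 'rV_m.+1 => r ord0 i) uE; rewrite !mxE => ->.
by rewrite mulKf.
Qed.

Definition pchart (j : 'I_m.+1) : set (projspace K m) := [set z | hcoord z j != 0].
(** The coordinate of index j is kept, although it is constantly 1 on the chart:
    this avoids renumbering the others. *)
Definition pcoord j z (b : 'I_m.+1) : K := hcoord z b / hcoord z j.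

Lemma homogenize (j : 'I_m.+1) (p : {mpoly K[m.+1]}) :
  exists e, exists2 h, h \is e.-homog &
    forall z, pchart j z -> h.@[hcoord z] = hcoord z j ^+ e * p.@[pcoord j z].
Proof.
elim/mpolyind: p => [|a mu p _ _ [e [h hh hE]]].
  by exists 0%N, 0; [exact: rpred0|move=> z _; rewrite !meval0 mulr0].
exists (mdeg mu + e)%N, (a *: 'X_[mu] * 'X_j ^+ e + 'X_j ^+ mdeg mu * h).
  have Xh k : ('X_j ^+ k : {mpoly K[m.+1]}) \is k.-homog.
    by rewrite -[X in X.-homog]mul1n; apply: dhomogMn; rewrite dhomogX /= mdeg1.
  apply: rpredD; last by apply: dhomogM.
  by apply: dhomogM => //; apply: rpredZ; rewrite dhomogX.
move=> z jz; rewrite !mevalD !mevalM !rmorphXn /= !mevalXU hE // !mevalZ mulrDr.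
congr (_ + _); last by rewrite mulrA exprD.
rewrite (_ : 'X_[mu].@[hcoord z] = hcoord z j ^+ mdeg mu * 'X_[mu].@[pcoord j z]).
  by rewrite exprD; set x := _ ^+ _; set y := _ ^+ _; set t := _.@[_]; ring.
rewrite -homog_scale ?dhomogX //; apply: meval_eq => i.
by rewrite /pcoord mulrCA divff ?mulr1.
Qed.

Lemma pchartP (j : 'I_m.+1) : affine_chart (pchart j) (pcoord j).
Proof.
split=> [p|A z cA jz nAz].
  have [e [h hh hE]] := homogenize j p.
  apply: proj_basic_open; exists (h * 'X_j).
    by exists (e + 1)%N; apply: dhomogM => //; rewrite dhomogX /= mdeg1.
  apply/seteqP; split=> z /=; rewrite mevalM mevalXU mulf_eq0 negb_or.
    by move=> [jz pz]; rewrite hE // mulf_neq0 // expf_neq0.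
  move=> /andP[hz jz]; split=> //; apply: contraNneq hz => pz.
  by rewrite hE // pz mulr0.
have [_ [h [e he] ->] [/= hz hA]] := open_proj_basic (closed_openC cA) nAz.
have hE y : pchart j y -> h.@[hcoord y] = hcoord y j ^+ e * h.@[pcoord j y].
  move=> jy; rewrite -homog_scale //; apply: meval_eq => i.
  by rewrite /pcoord mulrCA divff ?mulr1.
exists h; first by apply: contraNneq hz => h0; rewrite hE // h0 mulr0.
move=> y Ay jy; apply/eqP; apply: contrapT => /negP hy.
by apply: (hA y) => //=; rewrite hE // mulf_neq0 // expf_neq0.
Qed.

Lemma pchart_surj (j : 'I_m.+1) w : w j = 1 -> exists2 z, pchart j z & pcoord j z = w.
Proof.
move=> wj; have [|z [c c0 zE]] := @point_with_coordinates w.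
  by exists j; rewrite wj oner_neq0.
exists z; first by rewrite /pchart /= zE wj mulr1.
by apply/funext => i; rewrite /pcoord !zE wj mulr1 mulrC mulKf.
Qed.

(** A homogeneous polynomial cutting out a basic open set, the homogenization of p
    and X_j have a nonzero product, hence a common nonvanishing point. *)
Lemma pchart_open_dense j (p : {mpoly K[m.+1]}) w :
  w j = 1 -> p.@[w] != 0 -> dense (pchart j `&` [set z | p.@[pcoord j z] != 0]).
Proof.
move=> wj pw A [x Ax] oA; have [_ [h [e he] ->] [/= hx hA]] := open_proj_basic oA Ax.
have [e' [h' he' hE]] := homogenize j p.
have h0 : h != 0 by apply: contraNneq hx => ->; rewrite meval0.
have h'0 : h' != 0.
  have [z jz zw] := pchart_surj wj; move: pw; rewrite -zw; apply: contraNneq => h'0.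
  have /eqP := hE z jz; rewrite h'0 meval0 eq_sym mulf_eq0 => /orP[|->//].
  by rewrite expf_eq0 (negPf jz) andbF.
have Xj : ('X_j : {mpoly K[m.+1]}) != 0.
  by apply/eqP => /(congr1 (meval w)); rewrite mevalXU meval0 wj => /eqP; rewrite oner_eq0.
have [a] := mpoly_nonroot (mulf_neq0 (mulf_neq0 h0 h'0) Xj).
rewrite !mevalM !mulf_eq0 !negb_or mevalXU => /andP[/andP[ha h'a] aj].
have [|z [c c0 zE]] := @point_with_coordinates a; first by exists j.
have homE q k : q \is k.-homog -> q.@[a] != 0 -> q.@[hcoord z] != 0.
  by move=> qk qa; rewrite (meval_eq _ zE) (homog_scale _ _ qk) mulf_neq0 // expf_neq0.
have jz : pchart j z by rewrite /pchart /= zE mulf_neq0.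
exists z; split; first by apply: hA => /=; exact: (homE _ e).
split=> //=; have := homE _ _ he' h'a; rewrite hE // mulf_eq0 negb_or.
by case/andP.
Qed.

End ProjectiveSpace.

(** * Bihomogeneous coordinates *)

Section Biprojective.
Variables (K : numClosedFieldType) (d m : nat).
Implicit Types (f g : bipoly K d m) (xz : biproj K d m).

Lemma biproj_basic_open (B : set (biproj K d m)) : biproj_basic B -> open B.
Proof. by move=> hB; exists [set B]; [move=> _ ->|rewrite bigcup_set1]. Qed.

Lemma open_biproj_basic (A : set (biproj K d m)) xz :
  open A -> A xz -> exists2 B, biproj_basic B & B xz /\ B `<=` A.
Proof.
by move=> [D DB <-] [B DBB Bx]; exists B; [exact: DB|split=> // y By; exists B].
Qed.

Definition bideg f e1 e2 := f \is e1.-homog /\ forall mu, f@_mu \is e2.-homog.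

Lemma bidegM f g a b a' b' :
  bideg f a b -> bideg g a' b' -> bideg (f * g) (a + a') (b + b').
Proof.
move=> [fa fb] [ga gb]; split=> [|mu]; first exact: dhomogM.
by rewrite mcoeffM rpred_sum // => k _; exact: dhomogM.
Qed.

Lemma bidegD f g a b : bideg f a b -> bideg g a b -> bideg (f + g) a b.
Proof. by move=> [fa fb] [ga gb]; split=> [|mu]; rewrite ?mcoeffD rpredD. Qed.

Lemma bideg1 : bideg 1 0 0.
Proof.
split=> [|mu]; first exact: dhomog1.
by rewrite mcoeff1; case: eqP => _; [exact: dhomog1|exact: dhomog0].
Qed.

Lemma bidegX f a b k : bideg f a b -> bideg (f ^+ k) (k * a) (k * b).
Proof.
move=> fab; elim: k => [|k IH]; first exact: bideg1.
by rewrite exprS !mulSn; exact: bidegM.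
Qed.

Lemma bidegC (q : {mpoly K[m.+1]}) b : q \is b.-homog -> bideg q%:MP 0 b.
Proof.
move=> qb; split=> [|mu].
  by rewrite -alg_mpolyC rpredZ // dhomog1.
by rewrite mcoeffC; case: eqP => _; rewrite ?mulr1 // mulr0 dhomog0.
Qed.

Lemma bideg_var i : bideg 'X_i 1 0.
Proof.
split=> [|mu]; first by rewrite dhomogX /= mdeg1.
by rewrite mcoeffX; case: eqP => _; [exact: dhomog1|exact: dhomog0].
Qed.

Definition beval f (a : 'I_d.+1 -> K) (b : 'I_m.+1 -> K) :=
  (map_mpoly (meval b) f).@[a].

Lemma bevalE f a b : beval f a b =
  \sum_(mu <- msupp f) (f@_mu).@[b] * \prod_i a i ^+ mu i.
Proof.
rewrite /beval /map_mpoly /mmap raddf_sum /=; apply: eq_bigr => mu _.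
by rewrite mevalM mevalC /mmap1 rmorph_prod; congr (_ * _); apply: eq_bigr => i _;
  rewrite rmorphXn /= mevalXU.
Qed.

Lemma beval_scale f e1 e2 c c' a b : bideg f e1 e2 ->
  beval f (fun i => c * a i) (fun j => c' * b j) = c ^+ e1 * c' ^+ e2 * beval f a b.
Proof.
move=> [/dhomogP f1 f2]; rewrite !bevalE mulr_sumr; apply: eq_big_seq => mu /f1 mue.
rewrite (homog_scale _ _ (f2 mu)) -mue /= mdegE -prodrXr.
rewrite (eq_bigr (fun i => c ^+ mu i * a i ^+ mu i)) => [|i _]; last by rewrite exprMn.
by rewrite big_split /=; ring.
Qed.

Lemma bievalD f g x z : bieval (f + g) x z = bieval f x z + bieval g x z.
Proof. by rewrite /bieval /specialize rmorphD mevalD. Qed.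

Lemma bieval_var i x z : bieval ('X_i : bipoly K d m) x z = hcoord x i.
Proof. by rewrite /bieval /specialize map_mpolyX mevalXU. Qed.

Lemma bieval_param j x z : bieval (('X_j)%:MP : bipoly K d m) x z = hcoord z j.
Proof. by rewrite /bieval /specialize map_mpolyC /= mevalC mevalXU. Qed.

Definition join_coords (a : 'I_d.+1 -> K) (b : 'I_m.+1 -> K) (l : 'I_(d.+1 + m.+1)) : K :=
  match split l with inl i => a i | inr j => b j end.

Lemma join_coords_lshift a b i : join_coords a b (lshift _ i) = a i.
Proof. by rewrite /join_coords; case: split_ordP => j /eqP; rewrite ?eq_lshift ?eq_lrshift // => /eqP->. Qed.

Lemma join_coords_rshift a b j : join_coords a b (rshift _ j) = b j.
Proof. by rewrite /join_coords; case: split_ordP => i /eqP; rewrite ?eq_rshift ?eq_rlshift // => /eqP->. Qed.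

(** A polynomial over a polynomial ring, as a polynomial in all the variables: the
    x_i come first, the z_j last. *)
Definition flatten_poly f : {mpoly K[d.+1 + m.+1]} :=
  \sum_(mu <- msupp f) (f@_mu \mPo [tuple 'X_(rshift _ j) | j < m.+1])
     * \prod_(i < d.+1) 'X_(lshift _ i) ^+ mu i.

Lemma meval_flatten f a b : (flatten_poly f).@[join_coords a b] = beval f a b.
Proof.
rewrite bevalE /flatten_poly raddf_sum /=; apply: eq_bigr => mu _.
rewrite mevalM comp_mpoly_meval rmorph_prod /=; congr (_ * _).
  by apply: meval_eq => j; rewrite tnth_mktuple mevalXU join_coords_rshift.
by apply: eq_bigr => i _; rewrite rmorphXn /= mevalXU join_coords_lshift.
Qed.

Definition bichart i j : set (biproj K d m) :=
  [set xz | pchart i xz.1 /\ pchart j xz.2].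
Definition bicoord i j xz : 'I_(d.+1 + m.+1) -> K :=
  join_coords (pcoord i xz.1) (pcoord j xz.2).

Lemma bieval_chart i j f e1 e2 xz : bideg f e1 e2 -> bichart i j xz ->
  bieval f xz.1 xz.2 =
  hcoord xz.1 i ^+ e1 * hcoord xz.2 j ^+ e2 * (flatten_poly f).@[bicoord i j xz].
Proof.
move=> fe [xi zj]; rewrite meval_flatten -(beval_scale _ _ _ _ fe).
rewrite /bieval /specialize /beval.
have E1 : hcoord xz.1 =1 (fun i0 => hcoord xz.1 i * pcoord i xz.1 i0).
  by move=> k; rewrite /pcoord mulrCA divff ?mulr1.
have E2 : hcoord xz.2 =1 (fun j0 => hcoord xz.2 j * pcoord j xz.2 j0).
  by move=> k; rewrite /pcoord mulrCA divff ?mulr1.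
by rewrite (meval_eq _ E1) -(funext E2).
Qed.

(** The polynomials that become bihomogeneous after multiplication by powers of
    x_i and z_j form a subring containing the constants and the variables. *)
Lemma bihomogenize i j (p : {mpoly K[d.+1 + m.+1]}) :
  exists e1 e2, exists2 h, bideg h e1 e2 & forall xz, bichart i j xz ->
    bieval h xz.1 xz.2 =
    hcoord xz.1 i ^+ e1 * hcoord xz.2 j ^+ e2 * p.@[bicoord i j xz].
Proof.
pose reg p := exists e1 e2, exists2 h, bideg h e1 e2 & forall xz, bichart i j xz ->
    bieval h xz.1 xz.2 =
    hcoord xz.1 i ^+ e1 * hcoord xz.2 j ^+ e2 * p.@[bicoord i j xz].
have bievalX h k x z : bieval (h ^+ k) x z = bieval h x z ^+ k.
  by elim: k => [|k IH]; rewrite ?expr0 ?bieval1 // !exprS bievalM IH.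
have regM q r : reg q -> reg r -> reg (q * r).
  move=> [a [b [h hab hE]]] [a' [b' [h' hab' hE']]].
  exists (a + a')%N, (b + b')%N, (h * h'); first exact: bidegM.
  by move=> xz ij; rewrite bievalM hE // hE' // mevalM !exprD; ring.
have regC c : reg c%:MP.
  exists 0%N, 0%N, (c%:MP)%:MP; first by apply: bidegC; rewrite -alg_mpolyC rpredZ ?dhomog1.
  by move=> xz _; rewrite /bieval /specialize map_mpolyC /= !mevalC !expr0 !mul1r.
have regX l : reg 'X_l.
  have [k ->|k ->] := split_ordP l.
    exists 1%N, 0%N, 'X_k; first exact: bideg_var.
    move=> xz [xi _]; rewrite bieval_var mevalXU expr1 expr0 mulr1.
    by rewrite /bicoord join_coords_lshift /pcoord mulrCA divff ?mulr1.
  exists 0%N, 1%N, ('X_k)%:MP; first by apply: bidegC; rewrite dhomogX /= mdeg1.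
  move=> xz [_ zj]; rewrite bieval_param mevalXU.
  by rewrite expr1 expr0 mul1r /bicoord join_coords_rshift /pcoord mulrCA divff ?mulr1.
have regD q r : reg q -> reg r -> reg (q + r).
  move=> [a [b [h hab hE]]] [a' [b' [h' hab' hE']]].
  have Xi k : bideg ('X_i ^+ k : bipoly K d m) k 0.
    by have := bidegX k (bideg_var i); rewrite muln1 muln0.
  have Xj k : bideg (('X_j)%:MP ^+ k : bipoly K d m) 0 k.
    have := bidegX k (@bidegC 'X_j 1 _); rewrite muln1 muln0; apply.
    by rewrite dhomogX /= mdeg1.
  exists (a + a')%N, (b + b')%N,
    (h * 'X_i ^+ a' * ('X_j)%:MP ^+ b' + 'X_i ^+ a * ('X_j)%:MP ^+ b * h').
    apply: bidegD.
      by have := bidegM (bidegM hab (Xi a')) (Xj b'); rewrite !addn0.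
    by have := bidegM (bidegM (Xi a) (Xj b)) hab'; rewrite !addn0 !add0n.
  move=> xz ij; rewrite bievalD !bievalM !bievalX bieval_var bieval_param.
  rewrite hE // hE' // mevalD !exprD.
  by ring.
have reg0 : reg 0 by have := regC 0; rewrite mpolyC0.
have reg1 : reg 1 by have := regC 1; rewrite mpolyC1.
rewrite -/(reg p) (mpolyE p); apply: (big_ind reg reg0 regD) => mu _.
rewrite -mul_mpolyC; apply: (regM) => //; rewrite mpolyXE_id.
apply: (big_ind reg reg1 regM) => l _.
by elim: (mu l) => [|k IH]; rewrite ?expr0 ?exprS //; apply: (regM).
Qed.

Lemma bichartP i j : affine_chart (bichart i j) (bicoord i j).
Proof.
split=> [p|A xz cA ij nA].
  have [e1 [e2 [h he hE]]] := bihomogenize i j p.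
  apply: biproj_basic_open; exists (h * 'X_i * ('X_j)%:MP).
    have := bidegM (bidegM he (bideg_var i)) (@bidegC 'X_j 1 _).
    by rewrite dhomogX /= mdeg1 => /(_ isT) [? ?]; exists (e1 + 1 + 0)%N, (e2 + 0 + 1)%N.
  apply/seteqP; split=> xz /=; rewrite !bievalM bieval_var bieval_param !mulf_eq0 !negb_or.
    by move=> [[xi zj] pz]; rewrite xi zj hE // !mulf_neq0 // expf_neq0.
  move=> /andP[/andP[hz xi] zj]; split=> //; apply: contraNneq hz => pz.
  by rewrite hE // pz mulr0.
have [_ [h [e1 [e2 he]] ->] [/= hz hA]] := open_biproj_basic (closed_openC cA) nA.
exists (flatten_poly h).
  by apply: contraNneq hz => h0; rewrite (bieval_chart he ij) h0 mulr0.
move=> y Ay jy; apply/eqP; apply: contrapT => /negP hy.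
apply: (hA y) => //=; rewrite (bieval_chart he jy) // mulf_neq0 //.
by case: jy => xi zj; rewrite mulf_neq0 // expf_neq0.
Qed.

End Biprojective.

(** * Generic fibres of the logarithmic derivative *)

Lemma maximal_independent_coordinates (K : numClosedFieldType) T (S : set T) n
    (c : 'I_n -> T -> K) : S !=set0 ->
  exists t, (exists J : 'I_t -> 'I_n, ~ alg_dep S (fun l => c (J l))) /\
    forall J : 'I_t.+1 -> 'I_n, injective J -> alg_dep S (fun l => c (J l)).
Proof.
move=> S0; pose good t := `[< exists J : 'I_t -> 'I_n,
  injective J /\ ~ alg_dep S (fun l => c (J l)) >].
have good0 : exists t, good t.
  exists 0%N; apply/asboolP; exists (fun l : 'I_0 => False_rect _ (notF (ltn_ord l))).
  by split; [case|exact: alg_indep0].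
have goodn t : good t -> (t <= n)%N.
  move=> /asboolP[J [JI _]]; have := leq_card J JI; by rewrite !card_ord.
case: (ex_maxnP good0 goodn) => t /asboolP[J [_ Jind]] tmax; exists t; split; first by exists J.
move=> J' J'I; apply: contrapT => ind.
suff /tmax : good t.+1 by rewrite ltnn.
by apply/asboolP; exists J'.
Qed.

Lemma log_derivative_ratio (F : fieldType) (a n0 x s g h : F) :
  s != 0 -> x != 0 -> h != 0 -> n0 != 0 ->
  a / x + n0 * ((s * g / x) / (s * h)) = 0 -> g / h = - (a / n0).
Proof.
move=> s0 x0 h0 n00 E.
have {}E : a * h + n0 * g = 0.
  have : (a / x + n0 * ((s * g / x) / (s * h))) * (x * h) = 0 by rewrite E mul0r.
  by move=> <-; field; rewrite s0 x0 h0.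
apply/eqP; rewrite -subr_eq0; apply/eqP.
have -> : g / h - - (a / n0) = (a * h + n0 * g) / (n0 * h) by field; rewrite n00 h0.
by rewrite E mul0r.
Qed.

Section Fibres.
Variables (K : numClosedFieldType) (d m : nat).
Variables (f : bipoly K d m) (Z : set (projspace K m)).

(** A tuple containing the constant coordinate x_i / x_i is dependent. Any other
    injective tuple contains at most d of the x-coordinates, hence t + 1 of the
    z-coordinates, which are already dependent on Z. *)
Lemma bichart_coordinates_dep i j t :
  (forall J : 'I_t.+1 -> 'I_m.+1, injective J ->
     alg_dep (Z `&` pchart j) (fun l z => pcoord j z (J l))) ->
  forall J : 'I_(d + t.+1) -> 'I_(d.+1 + m.+1), injective J ->
    alg_dep ([set xz | Z xz.2] `&` bichart (d := d) i j)
      (fun l xz => bicoord i j xz (J l)).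
Proof.
move=> H J JI; have [[l Jl]|noi] := pselect (exists l, J l = lshift _ i).
  apply: (@alg_dep_const _ _ _ _ _ l 1) => xz [_ [xi _]].
  by rewrite Jl /bicoord join_coords_lshift /pcoord divff.
pose left_ix := [set l | (J l < d.+1)%N]%SET.
have left_small : (#|left_ix| <= d)%N.
  have di : #|[set~ i]%SET| = d by rewrite cardsC1 card_ord.
  rewrite -[leqRHS]di.
  rewrite -(card_imset _ (@lshift_inj d.+1 m.+1)) -(card_imset left_ix JI).
  apply/subset_leq_card/fintype.subsetP => y /imsetP[l].
  rewrite inE => Jl ->; have [k Jk|k Jk] := split_ordP (J l); last first.
    by move: Jl; rewrite Jk /= ltnNge leq_addr.
  rewrite Jk; apply: imset_f; rewrite !inE; apply/eqP => ki.
  by apply: noi; exists l; rewrite Jk ki.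
have right_big : (t.+1 <= #|~: left_ix|)%N.
  have := cardsC left_ix; rewrite card_ord => E.
  by rewrite -(leq_add2l d) -[leqLHS]E leq_add2r.
pose s (a : 'I_t.+1) := enum_val (widen_ord right_big a).
have sI : injective s by move=> a b /enum_val_inj/(congr1 val)/= /val_inj.
have /fin_all_exists[J' J'E] a : exists k, J (s a) = rshift _ k.
  have := enum_valP (widen_ord right_big a); rewrite !inE -/(s a).
  by have [k ->|k ->] := split_ordP (J (s a)); [|exists k].
have J'I : injective J'.
  by move=> a b ab; apply/sI/JI; rewrite !J'E ab.
apply: (alg_dep_reindex sI); have [P P0 PZ] := H J' J'I; exists P => // xz [Zz [_ zj]].
rewrite -[RHS](PZ xz.2) //; apply: meval_eq => a.
by rewrite J'E /bicoord join_coords_rshift.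
Qed.

Hypothesis bihomf : bihomog f.

(** The operator x_l d_l multiplies the coefficient of each monomial by an
    integer. *)
Lemma bideg_euler e1 e2 (l : 'I_d.+1) : bideg f e1 e2 -> bideg ('X_l * f^`M(l)) e1 e2.
Proof.
move=> [f1 f2].
have E mu : ('X_l * f^`M(l))@_mu = f@_mu *+ mu l.
  have [m0|] := posnP (mu l).
    rewrite m0 mulr0n mulrC; apply: memN_msupp_eq0; apply/negP => /msuppM_le.
    move=> /allpairsP[[a b] /= [_]]; rewrite msuppX inE => /eqP-> muE.
    by move: m0 => /eqP; rewrite muE mnmDE mnm1E eqxx addn_eq0 andbF.
  move=> ml; have -> : mu = (mu - U_(l) + U_(l))%MM.
    by rewrite submK //; apply/mnm_lepP => k; rewrite mnm1E; case: eqP => // <-.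
  by rewrite mulrC [in LHS]addmC mcoeffMX mcoeff_deriv mnmDE mnm1E eqxx addn1.
split=> [|mu]; last by rewrite E rpredMn.
apply/dhomogP => mu; rewrite mcoeff_msupp E => mu0.
by apply: (dhomogP _ _ _ f1); rewrite mcoeff_msupp; apply: contraNneq mu0 => ->; rewrite mul0rn.
Qed.

Lemma XF_coords xz : XF f Z xz ->
  [/\ Z xz.2, bieval f xz.1 xz.2 != 0 & forall l, hcoord xz.1 l != 0].
Proof.
move=> [Zz]; rewrite /Fpoly bievalM mulf_eq0 negb_or => /andP[X0 f0]; split=> // l.
move: X0; rewrite /bieval /specialize !rmorph_prod /= => /prodf_neq0/(_ l isT).
by rewrite map_mpolyX mevalXU.
Qed.

(** The values taken on Y°_nu by the functions x_a (d_a f) / f, for a = 1, .., d. *)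
Definition affine_ratios (nu : projspace K d) (a : 'I_d) : K :=
  - pcoord ord0 nu (lift ord0 a).

(** Let P(phi, w) = 0 be a relation between the d logarithmic derivatives and
    t + 1 coordinates. Since P(u, c) is not zero for some value c of the last
    variables, P(u, .) is a nontrivial relation for all u where the polynomial
    p = P(., c) does not vanish. *)
Lemma generic_fibre_relation i j t (w : 'I_t.+1 -> 'I_(d.+1 + m.+1)) :
  (forall J : 'I_(d + t.+1) -> 'I_(d.+1 + m.+1), injective J ->
    alg_dep ([set xz | Z xz.2] `&` bichart i j) (fun l xz => bicoord i j xz (J l))) ->
  exists2 p : {mpoly K[d]}, p != 0 &
    forall nu, pchart ord0 nu -> p.@[affine_ratios nu] != 0 ->
      alg_dep (Yo f Z nu `&` bichart i j) (fun b xz => bicoord i j xz (w b)).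
Proof.
move=> dep; have [e1 [e2 fe]] := bihomf; have {}fe : bideg f e1 e2 by [].
pose h := flatten_poly f.
pose g (l : 'I_(d + t.+1)) := match split l with
  | inl a => flatten_poly ('X_(lift ord0 a) * f^`M(lift ord0 a))
  | inr b => 'X_(w b) * h end.
have [P P0 PS] := alg_dep_quotients (c := fun l xz => bicoord i j xz l) g h dep.
have [c Pc] := mpoly_nonroot P0.
pose p : {mpoly K[d]} := P \mPo [tuple match split l with
  | inl a => 'X_a | inr b => (c l)%:MP end | l < d + t.+1].
have pE u : p.@[u] = P.@[fun l => match split l with inl a => u a | inr b => c l end].
  rewrite comp_mpoly_meval; apply: meval_eq => l; rewrite tnth_mktuple.
  by case: split => a; rewrite ?mevalXU ?mevalC.
exists p.
  apply: contra_neq Pc => p0; have := pE (fun a => c (lshift _ a)); rewrite p0 meval0.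
  by move=> ->; apply: meval_eq => l; case: split_ordP => k ->.
move=> nu nu0 pnu.
pose Q : {mpoly K[t.+1]} := P \mPo [tuple match split l with
  | inl a => (affine_ratios nu a)%:MP | inr b => 'X_b end | l < d + t.+1].
have QE u : Q.@[u] = P.@[fun l => match split l with
    inl a => affine_ratios nu a | inr b => u b end].
  rewrite comp_mpoly_meval; apply: meval_eq => l; rewrite tnth_mktuple.
  by case: split => a; rewrite ?mevalXU ?mevalC.
exists Q.
  apply: contra_neq pnu => Q0; have := QE (fun b => c (rshift _ b)); rewrite Q0 meval0.
  by rewrite pE => ->; apply: meval_eq => l; case: split_ordP => k lk //; rewrite lk.
move=> xz [[/XF_coords[Zz f0 x0] Yeq] ij].
have hE := bieval_chart fe ij; rewrite -/h in hE.
have h0 : h.@[bicoord i j xz] != 0.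
  by apply: contraNneq f0 => h0; rewrite hE h0 mulr0.
rewrite QE -[RHS](PS xz) //; apply: meval_eq => l; rewrite /g.
case: split => [a|b]; last by rewrite mevalM mevalXU mulfK.
have gE := bieval_chart (bideg_euler (lift ord0 a) fe) ij.
set ga := (flatten_poly _).@[_] in gE *.
have := Yeq (lift ord0 a) isT; rewrite bievalM bieval_var in gE.
have hne : hcoord xz.1 i ^+ e1 * hcoord xz.2 j ^+ e2 != 0.
  by case: ij => xi zj; rewrite mulf_neq0 // expf_neq0.
rewrite /affine_ratios /pcoord.
have -> : bieval f^`M(lift ord0 a) xz.1 xz.2 =
    hcoord xz.1 i ^+ e1 * hcoord xz.2 j ^+ e2 * ga / hcoord xz.1 (lift ord0 a).
  by rewrite -gE mulrC mulKf.
rewrite hE => E; symmetry; exact: (log_derivative_ratio hne (x0 _) h0 nu0 E).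
Qed.

End Fibres.

(** * The boundary of the likelihood correspondence *)

Section Boundary.
Variables (K : numClosedFieldType) (d m : nat).
Variables (f : bipoly K d m) (Z : set (projspace K m)).
Hypothesis bihomf : bihomog f.

Lemma bideg_Fpoly : exists e1 e2, bideg (Fpoly f) e1 e2.
Proof.
have [e1 [e2 fe]] := bihomf; rewrite /Fpoly.
suff [a Xa] : exists a, bideg (\prod_(i < d.+1) 'X_i : bipoly K d m) a 0.
  by exists (a + e1)%N, (0 + e2)%N; exact: bidegM.
elim/big_ind: _ => [|p q [a pa] [b qb]|i _].
- by exists 0%N; exact: bideg1.
- by exists (a + b)%N; rewrite -[0%N]/(0 + 0)%N; exact: bidegM.
- by exists 1%N; exact: bideg_var.
Qed.

Lemma fibre_functions_dep i j t nu :
  (forall w : 'I_t.+1 -> 'I_(d.+1 + m.+1),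
    alg_dep (Yo f Z nu `&` bichart i j) (fun b xz => bicoord i j xz (w b))) ->
  forall y : 'I_t.+1 -> {mpoly K[d.+1 + m.+1]},
    alg_dep (Yo f Z nu `&` bichart i j) (fun b xz => (y b).@[bicoord i j xz]).
Proof.
move=> dep y.
have [P P0 PS] := alg_dep_quotients (c := fun l xz => bicoord i j xz l) y 1
  (fun J _ => dep J).
exists P => // xz Yxz; rewrite -[RHS](PS xz); last by split=> //=; rewrite meval1 oner_neq0.
by apply: meval_eq => l; rewrite meval1 divr1.
Qed.

(** F vanishes on C and nowhere on Y°_nu, so adding F to k independent functions
    on C gives k + 1 independent functions on Y°_nu, where t + 1 functions are
    always dependent. *)
Lemma boundary_drop i j t nu (C : set (biproj K d m)) k
    (w : 'I_k -> {mpoly K[d.+1 + m.+1]}) :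
  (forall y : 'I_t.+1 -> {mpoly K[d.+1 + m.+1]},
    alg_dep (Yo f Z nu `&` bichart i j) (fun b xz => (y b).@[bicoord i j xz])) ->
  C `<=` Y f Z nu `&` VF f Z ->
  ~ alg_dep (C `&` bichart i j) (fun l xz => (w l).@[bicoord i j xz]) ->
  (k < t)%N.
Proof.
move=> dep CY ind; rewrite ltnNge; apply/negP => tk.
have [e1 [e2 Fe]] := bideg_Fpoly.
suff : ~ alg_dep (Yo f Z nu `&` bichart i j) (fun l xz =>
    (oapp w (flatten_poly (Fpoly f)) (unlift (@ord_max k) l)).@[bicoord i j xz]).
  apply; have tk' : (t.+1 <= k.+1)%N by [].
  apply: (alg_dep_reindex (s := widen_ord tk')).
    by move=> a b /(congr1 val)/= /val_inj.
  exact: (dep (fun b => oapp w _ (unlift ord_max (widen_ord tk' b)))).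
apply: alg_indep_extend ind => [xz [/CY[_ [_ F0]] ij]|a q qF xz [/CY[[cl _] _] ij]].
  move: F0; rewrite (bieval_chart Fe ij) => /eqP; rewrite mulf_eq0 => /orP[|/eqP//].
  by case: ij => xi zj; rewrite mulf_eq0 !expf_eq0 (negPf xi) (negPf zj) !andbF.
apply: (chart_closure (bichartP _ i j) _ cl ij) => yz Yyz yij.
have := qF yz (conj Yyz yij); rewrite mevalM rmorphXn /= => /eqP.
rewrite mulf_eq0 expf_eq0 => /orP[/andP[_ /eqP F0]|/eqP//].
by case: Yyz => -[_ /eqP[]]; rewrite (bieval_chart Fe yij) F0 mulr0.
Qed.

(** The conditions on nu from [generic_fibre_relation] for all charts and all
    tuples of coordinates, which are finitely many, are multiplied together. *)
Lemma generic_parameters :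
  exists2 p : {mpoly K[d]}, p != 0 & forall j, (Z `&` pchart j) !=set0 ->
    exists t, (exists J : 'I_t -> 'I_m.+1,
        ~ alg_dep (Z `&` pchart j) (fun l z => pcoord j z (J l))) /\
      forall nu i, pchart ord0 nu -> p.@[affine_ratios nu] != 0 ->
      forall y : 'I_t.+1 -> {mpoly K[d.+1 + m.+1]},
        alg_dep (Yo f Z nu `&` bichart i j) (fun b xz => (y b).@[bicoord i j xz]).
Proof.
have /choice[t tP] j : exists t, (Z `&` pchart j) !=set0 ->
    (exists J : 'I_t -> 'I_m.+1,
       ~ alg_dep (Z `&` pchart j) (fun l z => pcoord j z (J l))) /\
    forall J : 'I_t.+1 -> 'I_m.+1, injective J ->
       alg_dep (Z `&` pchart j) (fun l z => pcoord j z (J l)).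
  have [Zj|nZ] := pselect ((Z `&` pchart j) !=set0); last by exists 0%N.
  have [t tH] := maximal_independent_coordinates (fun l z => pcoord j z l) Zj.
  by exists t.
have /choice[p pP] ij : exists p : {mpoly K[d]}, p != 0 /\
    ((Z `&` pchart ij.2) !=set0 -> forall nu, pchart ord0 nu ->
      p.@[affine_ratios nu] != 0 ->
      forall w : 'I_(t ij.2).+1 -> 'I_(d.+1 + m.+1),
      alg_dep (Yo f Z nu `&` bichart ij.1 ij.2)
        (fun b xz => bicoord ij.1 ij.2 xz (w b))).
  case: ij => i j /=.
  have [Zj|nZ] := pselect ((Z `&` pchart j) !=set0); last first.
    by exists 1; split=> //; exact: oner_neq0.
  have dep := bichart_coordinates_dep i (tP j Zj).2.
  have /choice[p pP] (w : {ffun 'I_(t j).+1 -> 'I_(d.+1 + m.+1)}) :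
      exists p : {mpoly K[d]}, p != 0 /\
    forall nu, pchart ord0 nu -> p.@[affine_ratios nu] != 0 ->
      alg_dep (Yo f Z nu `&` bichart i j) (fun b xz => bicoord i j xz (w b)).
    by have [p p0 pH] := generic_fibre_relation bihomf w dep; exists p.
  exists (\prod_w p w); split; first by apply/prodf_neq0 => w _; case: (pP w).
  move=> _ nu nu0; rewrite rmorph_prod /= => /prodf_neq0 pnu w.
  have [P P0 PY] := (pP [ffun b => w b]).2 nu nu0 (pnu _ isT).
  exists P => // xz /PY; rewrite (@meval_eq _ _ _ (fun b => bicoord i j xz (w b))) //.
  by move=> b; rewrite ffunE.
exists (\prod_(ij : 'I_d.+1 * 'I_m.+1) p ij).
  by apply/prodf_neq0 => ij _; case: (pP ij).
move=> j Zj; exists (t j); split; first exact: (tP j Zj).1.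
move=> nu i nu0; rewrite rmorph_prod /= => /prodf_neq0 pnu.
apply: fibre_functions_dep; exact: (pP (i, j)).2 Zj nu nu0 (pnu (i, j) isT).
Qed.

Lemma generic_parameters_open_dense (p : {mpoly K[d]}) : p != 0 ->
  let U := pchart ord0 `&` [set nu : projspace K d | p.@[affine_ratios nu] != 0] in
  open U /\ dense U.
Proof.
move=> p0; pose q : {mpoly K[d.+1]} := p \mPo [tuple - 'X_(lift ord0 a) | a < d].
have qE w : q.@[w] = p.@[fun a => - w (lift ord0 a)].
  by rewrite comp_mpoly_meval; apply: meval_eq => a; rewrite tnth_mktuple mevalN mevalXU.
have [a pa] := mpoly_nonroot p0.
pose w (l : 'I_d.+1) := oapp (fun b => - a b) 1 (unlift ord0 l).
have qw : q.@[w] != 0.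
  by rewrite qE (@meval_eq _ _ _ a) // => b; rewrite /w liftK /= opprK.
have -> : pchart ord0 `&` [set nu : projspace K d | p.@[affine_ratios nu] != 0] =
    pchart ord0 `&` [set nu | q.@[pcoord ord0 nu] != 0].
  by apply/seteqP; split=> nu /= [? H]; split=> //; move: H; rewrite qE.
split; first exact: (pchartP _ ord0).1.
by apply: pchart_open_dense qw; rewrite /w unlift_none.
Qed.

End Boundary.

Theorem proposition5p8 (R : realType) (d m : nat)
    (f : bipoly R[i] d m) (Z : set (projspace R[i] m)) :
  bihomog f ->
  quasi_projective Z ->
  irreducible Z ->
  (forall z, Z z -> specialize f z <> 0) ->
  exists U : set (projspace R[i] d),
    [/\ open U, dense U &
      forall nu, U nu ->
        (krull_dim R (Y f Z nu `&` VF f Z) <= krull_dim R Z - 1)%E /\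
        snd @` (Y f Z nu `&` VF f Z) `<` Z].
Proof.
move=> bihomf [A [V [cA oV ZE]]] irrZ _.
have [p p0 pP] := generic_parameters Z bihomf.
exists (pchart ord0 `&` [set nu | p.@[affine_ratios nu] != 0]).
have [oU dU] := generic_parameters_open_dense p0.
split=> // nu [nu0 pnu]; split.
- apply: ge_ereal_sup => _ [k [C Cchain] <-].
  have [[[x0 Cx0] _] _] := Cchain.1 0%N (leq0n k).
  have Csub : C k `<=` Y f Z nu `&` VF f Z.
    by have [_ [B _ ->]] := Cchain.1 k (leqnn k); move=> y [].
  have C0sub : C 0%N `<=` Y f Z nu `&` VF f Z.
    by have [_ [B _ ->]] := Cchain.1 0%N (leq0n k); move=> y [].
  have [i xi] := hcoord_neq0 x0.1; have [j zj] := hcoord_neq0 x0.2.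
  have [w ind] := chain_independent (bichartP _ i j) Cchain Cx0 (conj xi zj).
  have Zj : (Z `&` pchart j) !=set0.
    by exists x0.2; split=> //; have [[]] := C0sub _ Cx0.
  have [t [[J Jind] dep]] := pP j Zj.
  have kt : (k < t)%N := boundary_drop bihomf (dep nu i nu0 pnu) Csub ind.
  have [D Dchain] : exists D, irreducible_chain Z t D.
    apply: (chain_of_independent_coordinates (pchartP _ j) (G1 := [set 'X_j - 1])
      cA oV ZE irrZ _ _ Jind) => [v vj|z _ zj' ->].
      apply: pchart_surj; apply/eqP; rewrite -subr_eq0 -(mevalXU v) -(meval1 v) -mevalB.
      by apply/eqP/vj.
    by rewrite mevalB mevalXU meval1 /pcoord divff ?subrr.
  rewrite leeBrDr //; apply: (@le_trans _ _ t%:R%:E).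
    by rewrite -EFinD lee_fin natr1 ler_nat.
  by apply: ereal_sup_ubound; exists t => //; exists D.
- split=> [z [xz [[_ /= Zz] _] <-]//|sub].
  have [[z Zz] _] := irrZ; have [j zj] := hcoord_neq0 z.
  have [|t [[J Jind] dep]] := pP j; first by exists z.
  apply: Jind.
  have H i : alg_dep ((Y f Z nu `&` VF f Z) `&` bichart i j)
      (fun l xz => ('X_(rshift _ (J l)) : {mpoly _[d.+1 + m.+1]}).@[bicoord i j xz]).
    apply: contrapT => /(boundary_drop bihomf (dep nu i nu0 pnu) (@subset_refl _ _)).
    by rewrite ltnn.
  pose S i := [set z | exists2 xz, ((Y f Z nu `&` VF f Z) `&` bichart i j) xz & xz.2 = z].
  have : alg_dep (\bigcup_i S i) (fun l z => pcoord j z (J l)).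
    apply: alg_dep_bigcup => i; have [P P0 PS] := H i.
    exists P => // _ [xz hxz <-]; rewrite -[RHS](PS xz hxz); apply: meval_eq => l.
    by rewrite mevalXU /bicoord join_coords_rshift.
  apply: alg_dep_sub => z' [/sub[xz Yxz <-] zj'].
  have [i xi] := hcoord_neq0 xz.1.
  by exists i => //; exists xz.
Qed.
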